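(* Let $0 \le \alpha < 1$ and let $f = h + \overline{g} \in \mathcal{F}(\alpha)$. For each $\lambda \in \mathbb{C}$ with $|\lambda| = 1$ put $F_\lambda(z) := h(z) + \lambda g(z)$, $z \in \mathbb{D}$. Then for every $r \in (0,1)$, every $\lambda$ with $|\lambda|=1$, and all $t, \psi \in \mathbb{R}$ with $re^{it} \neq re^{i\psi}$, $$\left|\frac{F_\lambda(re^{it}) - F_\lambda(re^{i\psi})}{re^{it} - re^{i\psi}}\right| \ \ge\ A(r,\alpha) \quad\text{and}\quad \left|\frac{f(re^{it}) - f(re^{i\psi})}{re^{it} - re^{i\psi}}\right| \ \ge\ A(r,\alpha),$$ where $A(r,\alpha) := \dfrac{1-r^2}{r^2}\, L(r,\alpha)^2$ and $$L(r,\alpha) := \begin{cases} \dfrac{2r}{1+r} - \log(1+r), & \alpha = 0,\\[2mm] 2\log(1+r) - r, & \alpha = 1/2,\\[2mm] \dfrac{(1+r)^{2\alpha}(1+r+2\alpha - 2r\alpha) - (1+r)(1+2\alpha)}{2\alpha(1+r)(2\alpha-1)}, & \alpha \in (0,1)\setminus\{1/2\}.\end{cases}$$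
   Context: $\mathbb{D} = \{z \in \mathbb{C} : |z| < 1\}$. For $\alpha \ge -1/2$, $\mathcal{F}(\alpha)$ denotes the set of complex-valued harmonic functions $f = h + \overline{g}$ on $\mathbb{D}$, with $h, g$ analytic in $\mathbb{D}$ normalized by $h(0) = g(0) = 0$, $h'(0) = 1$, such that $\operatorname{Re}\left(1 + \frac{z h''(z)}{h'(z)}\right) > \alpha$ for all $z \in \mathbb{D}$ and, for some real constant $\theta$, $g'(z) = e^{i\theta} z h'(z)$ for all $z \in \mathbb{D}$. (Equivalently, $L(r,\alpha) = \int_0^r (1-\rho)(1+\rho)^{-2(1-\alpha)}\,d\rho$.) *)

(* Defs.v *)
From Stdlib Require Import Reals.
Open Scope R_scope.

Definition Cpx : Type := (R * R)%type.

Definition RtoC (x : R) : Cpx := (x, 0).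
Definition Cre (z : Cpx) : R := fst z.
Definition Cim (z : Cpx) : R := snd z.
Definition Cadd (z w : Cpx) : Cpx := (fst z + fst w, snd z + snd w).
Definition Copp (z : Cpx) : Cpx := (- fst z, - snd z).
Definition Csub (z w : Cpx) : Cpx := Cadd z (Copp w).
Definition Cmul (z w : Cpx) : Cpx :=
  (fst z * fst w - snd z * snd w, fst z * snd w + snd z * fst w).
Definition Cinv (z : Cpx) : Cpx :=
  (fst z / (fst z ^ 2 + snd z ^ 2), - snd z / (fst z ^ 2 + snd z ^ 2)).
Definition Cdiv (z w : Cpx) : Cpx := Cmul z (Cinv w).
Definition Cconj (z : Cpx) : Cpx := (fst z, - snd z).
Definition Cmod (z : Cpx) : R := sqrt (fst z ^ 2 + snd z ^ 2).
Definition Cexpi (t : R) : Cpx := (cos t, sin t).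
Definition C0 : Cpx := (0, 0).
Definition C1 : Cpx := (1, 0).

Definition inD (z : Cpx) : Prop := Cmod z < 1.

Definition cderiv (f : Cpx -> Cpx) (z l : Cpx) : Prop :=
  forall eps, 0 < eps -> exists delta, 0 < delta /\
    forall w, w <> z -> Cmod (Csub w z) < delta ->
      Cmod (Csub (Cdiv (Csub (f w) (f z)) (Csub w z)) l) < eps.

(* f = h + conj g belongs to F(alpha): h, g analytic (complex differentiable)
   on D with derivatives h1 = h', h2 = h'', g1 = g', normalized,
   Re(1 + z h''/h') > alpha (h' nonvanishing so the quotient makes sense),
   and g' = e^{i theta} z h'. *)
Definition in_F (alpha : R) (h g : Cpx -> Cpx) : Prop :=
  exists (h1 h2 g1 : Cpx -> Cpx) (theta : R),
    (forall z, inD z -> cderiv h z (h1 z)) /\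
    (forall z, inD z -> cderiv h1 z (h2 z)) /\
    (forall z, inD z -> cderiv g z (g1 z)) /\
    h C0 = C0 /\ g C0 = C0 /\ h1 C0 = C1 /\
    (forall z, inD z -> h1 z <> C0 /\
        alpha < Cre (Cadd C1 (Cdiv (Cmul z (h2 z)) (h1 z)))) /\
    (forall z, inD z -> g1 z = Cmul (Cexpi theta) (Cmul z (h1 z))).

Definition Lfun (r alpha : R) : R :=
  if Req_EM_T alpha 0 then 2 * r / (1 + r) - ln (1 + r)
  else if Req_EM_T alpha (1/2) then 2 * ln (1 + r) - r
  else (Rpower (1 + r) (2 * alpha) * (1 + r + 2 * alpha - 2 * r * alpha)
          - (1 + r) * (1 + 2 * alpha))
       / (2 * alpha * (1 + r) * (2 * alpha - 1)).

Definition Afun (r alpha : R) : R := (1 - r ^ 2) / r ^ 2 * (Lfun r alpha) ^ 2.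

Definition polar (r t : R) : Cpx := Cmul (RtoC r) (Cexpi t).

(* Main.v *)
(* Let beta = 1 - alpha. Both quotients are bounded below through h alone: on
   |z| <= r one has |g a - g b| <= r |h a - h b|, because |g'| <= r |h'| there
   and h maps the disc |z| <= r one-to-one onto a convex set, so that increments
   of g are integrals of g'/h' over segments. The same principle applied to the
   identity gives |a - b| <= (1 + r)^(2 beta) |h a - h b|, from the distortion
   bound |h' z| >= (1 + |z|)^(-2 beta). Hence both quotients are at least
   (1 - r) (1 + r)^(-2 beta), and this exceeds A(r, alpha) because
   L(r, alpha) <= r (1 + r)^(-beta - 1/2): both sides vanish at r = 0 and their
   derivatives compare by Bernoulli's inequality.

   The distortion bound is Harnack's inequality for the real part of
   log h'(lam z) - log h'(z) + beta log lam as lam tends to 1. Working with this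
   difference instead of z h''/h' avoids any regularity of h'', and Goursat's
   lemma supplies the mean value property for functions that are merely complex
   differentiable. *)

From Stdlib Require Import Reals Lra Lia Psatz Classical ClassicalEpsilon.
Require Import Defs.
From Coquelicot Require Import Coquelicot.
Open Scope R_scope.

(** * Complex differentiability *)

(** Goursat's lemma is applied only once, to get one mean value inequality. Every later bound is
    either monotonicity of a real function along a radius or a circle, from the mean value theorem,
    or a first-order condition at a maximum over a closed disc. No derivative is ever integrated.

    The factor 1 - r comes from the triangle inequality: the increments of lambda g and of conj g
    have the same modulus, at most r times that of h, so the analytic and the harmonic quotient
    share one estimate. The exponent -beta - 1/2 is forced by the target: after squaring r
    (1+r)^(-beta-1/2), the r^2 cancels in [Afun] and the spare factor 1/(1+r) turns 1 - r^2 into 1 -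
    r.

    The condition alpha >= 0 enters through convexity: Re(1 + z h''/h') is the rate at which the
    tangent to the image of a circle turns. *)

Definition ccont (f : C -> C) (z : C) : Prop :=
  forall eps, 0 < eps -> exists delta, 0 < delta /\
    forall w, Cmod (w - z)%C < delta -> Cmod (f w - f z)%C < eps.

(** Multiplied out, so that w = z is allowed and no quotient has to be simplified; this is the
    complex form of [differentiable_pt_lim]. *)
Definition cder (f : C -> C) (z l : C) : Prop :=
  forall eps, 0 < eps -> exists delta, 0 < delta /\
    forall w, Cmod (w - z)%C < delta ->
      Cmod (f w - f z - l * (w - z))%C <= eps * Cmod (w - z)%C.

Lemma Re_le_Cmod (z : C) : Re z <= Cmod z.
Proof. generalize (re_le_Cmod z); unfold Rabs; destruct (Rcase_abs _); lra. Qed.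

Lemma Cmod_sqr (z : C) : Cmod z * Cmod z = Re z * Re z + Im z * Im z.
Proof. generalize (Cmod2_alt z); simpl; lra. Qed.

Lemma Cmod_minus_sym (z w : C) : Cmod (z - w)%C = Cmod (w - z)%C.
Proof. rewrite <- Cmod_opp; f_equal; ring. Qed.

Lemma Cminus_0_r (z : C) : (z - 0)%C = z.
Proof. ring. Qed.

Lemma Cmod_triangle_sub (z w : C) : Cmod z - Cmod w <= Cmod (z - w)%C.
Proof.
  generalize (Cmod_triangle (z - w)%C w).
  replace (z - w + w)%C with z by ring; lra.
Qed.

Lemma Cmod_neq_0 (z : C) : 0 < Cmod z -> z <> 0.
Proof. intros H; apply Cmod_gt_0; exact H. Qed.

Lemma Cminus_neq_0 (z w : C) : z <> w -> (z - w)%C <> 0.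
Proof.
  intros H E; apply H.
  replace z with (z - w + w)%C by ring; rewrite E; ring.
Qed.

Lemma Cmod_le_abs (x y : R) : Cmod (x, y) <= Rabs x + Rabs y.
Proof.
  replace (x, y) with ((x, 0) + (0, y))%C by (unfold Cplus; simpl; f_equal; ring).
  eapply Rle_trans; [apply Cmod_triangle|].
  unfold Cmod at 1 2; simpl.
  apply Req_le; f_equal; rewrite <- sqrt_Rsqr_abs; f_equal; unfold Rsqr; ring.
Qed.

(** The Cauchy-Riemann equations: multiplication by a + ib has the real matrix with rows (a, -b) and
    (b, a). Products, compositions and inverses then follow from the rules for real functions of two
    variables. The halves of [eps] pay for passing between the modulus and the maximum norm. *)
Lemma cder_iff (f : C -> C) (x y a b : R) :
  cder f (x, y) (a, b) <->
  differentiable_pt_lim (fun u v => fst (f (u, v))) x y a (- b) /\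
  differentiable_pt_lim (fun u v => snd (f (u, v))) x y b a.
Proof.
  split.
  - intros H; split; intros [eps Heps];
    (destruct (H (eps / 2) ltac:(lra)) as [d [Hd K]];
     assert (Hd2 : 0 < d / 2) by lra; exists (mkposreal _ Hd2); simpl;
     intros u v Hu Hv;
     assert (Hm : Cmod ((u, v) - (x, y))%C <= Rabs (u - x) + Rabs (v - y))
       by apply (Cmod_le_abs (u - x) (v - y));
     specialize (K (u, v) ltac:(lra));
     generalize (Rmax_l (Rabs (u - x)) (Rabs (v - y)))
                (Rmax_r (Rabs (u - x)) (Rabs (v - y))); intros M1 M2;
     match type of K with Cmod ?w <= _ =>
       generalize (Rmax_Cmod w); intros Q;
       generalize (Rmax_l (Rabs (fst w)) (Rabs (snd w)))
                (Rmax_r (Rabs (fst w)) (Rabs (snd w))); intros N1 N2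
     end).
    + match goal with |- Rabs ?s <= _ =>
        match type of N1 with Rabs ?t <= _ => replace s with t by (simpl; ring) end end.
      nra.
    + match goal with |- Rabs ?s <= _ =>
        match type of N2 with Rabs ?t <= _ => replace s with t by (simpl; ring) end end.
      nra.
  - intros [H1 H2] eps Heps.
    assert (He : 0 < eps / 2) by lra.
    destruct (H1 (mkposreal _ He)) as [d1 K1].
    destruct (H2 (mkposreal _ He)) as [d2 K2].
    simpl in K1, K2.
    exists (Rmin d1 d2); split; [apply Rmin_pos; [apply d1|apply d2]|].
    intros [u v] Hw.
    generalize (Rmax_Cmod ((u, v) - (x, y))%C) (Rmin_l d1 d2) (Rmin_r d1 d2); simpl.
    intros M R1 R2.
    change (u + - x) with (u - x) in M; change (v + - y) with (v - y) in M.
    generalize (Rmax_l (Rabs (u - x)) (Rabs (v - y)))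
                (Rmax_r (Rabs (u - x)) (Rabs (v - y))); intros M1 M2.
    specialize (K1 u v ltac:(lra) ltac:(lra)).
    specialize (K2 u v ltac:(lra) ltac:(lra)).
    match goal with |- Cmod ?w <= _ => rewrite (surjective_pairing w) end.
    eapply Rle_trans; [apply Cmod_le_abs|]; simpl.
    match type of K1 with Rabs ?s <= _ => match goal with |- Rabs ?t + _ <= _ =>
       replace t with s by ring end end.
    match type of K2 with Rabs ?s <= _ => match goal with |- _ + Rabs ?t <= _ =>
       replace t with s by ring end end.
    nra.
Qed.

Lemma cder_ccont (f : C -> C) (z l : C) : cder f z l -> ccont f z.
Proof.
  intros H eps Heps.
  destruct (H 1 Rlt_0_1) as [d [Hd K]].
  assert (Hl := Cmod_ge_0 l).
  assert (Hq : 0 < eps / (2 + Cmod l)) by (apply Rdiv_lt_0_compat; lra).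
  exists (Rmin d (eps / (2 + Cmod l))); split; [now apply Rmin_pos|].
  intros w Hw.
  generalize (Rmin_l d (eps / (2 + Cmod l))) (Rmin_r d (eps / (2 + Cmod l))); intros M1 M2.
  specialize (K w ltac:(lra)).
  replace (f w - f z)%C with ((f w - f z - l * (w - z)) + l * (w - z))%C by ring.
  eapply Rle_lt_trans; [apply Cmod_triangle|].
  rewrite Cmod_mult.
  assert (Hw0 := Cmod_ge_0 (w - z)%C).
  assert (Cmod (w - z)%C * (2 + Cmod l) < eps).
  { replace eps with (eps / (2 + Cmod l) * (2 + Cmod l)) by (field; lra).
    apply Rmult_lt_compat_r; lra. }
  nra.
Qed.

Lemma dpl_plus (f g : R -> R -> R) x y a b c d :
  differentiable_pt_lim f x y a b -> differentiable_pt_lim g x y c d ->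
  differentiable_pt_lim (fun u v => f u v + g u v) x y (a + c) (b + d).
Proof.
  intros Hf Hg.
  replace (a + c) with (1 * a + 1 * c) by ring.
  replace (b + d) with (1 * b + 1 * d) by ring.
  apply (differentiable_pt_lim_comp Rplus f g x y 1 1); auto.
  intros eps; exists (mkposreal _ Rlt_0_1); intros u v _ _.
  replace (u + v - (f x y + g x y) - (1 * (u - f x y) + 1 * (v - g x y))) with 0 by ring.
  rewrite Rabs_R0; apply Rmult_le_pos; [apply Rlt_le, eps|].
  eapply Rle_trans; [apply Rabs_pos|apply Rmax_l].
Qed.

Lemma dpl_mult (f g : R -> R -> R) x y a b c d :
  differentiable_pt_lim f x y a b -> differentiable_pt_lim g x y c d ->
  differentiable_pt_lim (fun u v => f u v * g u v) x y
    (g x y * a + f x y * c) (g x y * b + f x y * d).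
Proof.
  intros Hf Hg.
  apply (differentiable_pt_lim_comp Rmult f g x y (g x y) (f x y)); auto.
  intros eps; exists eps; intros u v Hu Hv.
  replace (u * v - f x y * g x y - (g x y * (u - f x y) + f x y * (v - g x y)))
    with ((u - f x y) * (v - g x y)) by ring.
  rewrite Rabs_mult.
  generalize (Rmax_l (Rabs (u - f x y)) (Rabs (v - g x y)))
             (Rmax_r (Rabs (u - f x y)) (Rabs (v - g x y)))
             (Rabs_pos (u - f x y)) (Rabs_pos (v - g x y)).
  intros; apply Rmult_le_compat; lra.
Qed.

Lemma dpl_comp1 (p : R -> R) (f : R -> R -> R) x y a b l :
  is_derive p (f x y) l -> differentiable_pt_lim f x y a b ->
  differentiable_pt_lim (fun u v => p (f u v)) x y (l * a) (l * b).
Proof.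
  intros Hp Hf.
  replace (l * a) with (l * a + 0 * a) by ring.
  replace (l * b) with (l * b + 0 * b) by ring.
  apply (differentiable_pt_lim_comp (fun u _ => p u) f f); auto.
  apply differentiable_pt_lim_proj1_0; now apply is_derive_Reals.
Qed.

Lemma dpl_fst x y : differentiable_pt_lim (fun u _ => u) x y 1 0.
Proof. apply (differentiable_pt_lim_proj1_0 (fun u => u)), derivable_pt_lim_id. Qed.

Lemma dpl_snd x y : differentiable_pt_lim (fun _ v => v) x y 0 1.
Proof.
  intros eps; exists (mkposreal _ Rlt_0_1); intros u v _ _.
  replace (v - y - (0 * (u - x) + 1 * (v - y))) with 0 by ring.
  rewrite Rabs_R0; apply Rmult_le_pos; [apply Rlt_le, eps|].
  eapply Rle_trans; [apply Rabs_pos|apply Rmax_l].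
Qed.

Lemma dpl_ext (f g : R -> R -> R) x y a b a' b' :
  (forall u v, f u v = g u v) -> a = a' -> b = b' ->
  differentiable_pt_lim f x y a b -> differentiable_pt_lim g x y a' b'.
Proof.
  intros E <- <-; apply differentiable_pt_lim_ext.
  exists (mkposreal _ Rlt_0_1); intros; apply E.
Qed.

Lemma cder_const (c z : C) : cder (fun _ => c) z 0.
Proof.
  intros eps Heps; exists 1; split; [lra|]; intros w _.
  replace (c - c - 0 * (w - z))%C with (RtoC 0) by ring.
  rewrite Cmod_0; apply Rmult_le_pos; [lra|apply Cmod_ge_0].
Qed.

Lemma cder_id (z : C) : cder (fun w => w) z 1.
Proof.
  intros eps Heps; exists 1; split; [lra|]; intros w _.
  replace (w - z - 1 * (w - z))%C with (RtoC 0) by ring.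
  rewrite Cmod_0; apply Rmult_le_pos; [lra|apply Cmod_ge_0].
Qed.

Lemma cder_ext_loc (f g : C -> C) (z l l' : C) (d : R) :
  0 < d -> (forall w, Cmod (w - z)%C < d -> f w = g w) -> l = l' ->
  cder f z l -> cder g z l'.
Proof.
  intros Hd E <- H eps Heps.
  destruct (H eps Heps) as [d' [Hd' K]].
  exists (Rmin d d'); split; [now apply Rmin_pos|].
  intros w Hw; generalize (Rmin_l d d') (Rmin_r d d'); intros.
  rewrite <- !E; try lra; [apply K; lra|].
  replace (z - z)%C with (RtoC 0) by ring; rewrite Cmod_0; lra.
Qed.

Lemma cder_ext (f g : C -> C) (z l l' : C) :
  (forall w, f w = g w) -> l = l' -> cder f z l -> cder g z l'.
Proof. intros E; apply (cder_ext_loc f g z l l' 1 Rlt_0_1); auto. Qed.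

Lemma cder_plus (f g : C -> C) (z a b : C) :
  cder f z a -> cder g z b -> cder (fun w => f w + g w)%C z (a + b)%C.
Proof.
  destruct z as [x y], a as [a1 a2], b as [b1 b2].
  intros [F1 F2]%cder_iff [G1 G2]%cder_iff.
  apply cder_iff; split.
  - eapply dpl_ext; [| | |apply (dpl_plus _ _ _ _ _ _ _ _ F1 G1)]; simpl; intros; ring.
  - eapply dpl_ext; [| | |apply (dpl_plus _ _ _ _ _ _ _ _ F2 G2)]; simpl; intros; ring.
Qed.

Lemma cder_mult (f g : C -> C) (z a b : C) :
  cder f z a -> cder g z b -> cder (fun w => f w * g w)%C z (a * g z + f z * b)%C.
Proof.
  destruct z as [x y], a as [a1 a2], b as [b1 b2].
  intros [F1 F2]%cder_iff [G1 G2]%cder_iff.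
  apply cder_iff; split.
  - assert (K1 := dpl_mult _ _ _ _ _ _ _ _ F1 G1).
    assert (K2 := dpl_mult _ _ _ _ _ _ _ _ F2 G2).
    assert (K3 := dpl_comp1 (fun t => - t) _ _ _ _ _ (-1)
      ltac:(auto_derive; [auto|ring]) K2).
    eapply dpl_ext; [| | |apply (dpl_plus _ _ _ _ _ _ _ _ K1 K3)]; simpl; intros; ring.
  - assert (K1 := dpl_mult _ _ _ _ _ _ _ _ F1 G2).
    assert (K2 := dpl_mult _ _ _ _ _ _ _ _ F2 G1).
    eapply dpl_ext; [| | |apply (dpl_plus _ _ _ _ _ _ _ _ K1 K2)]; simpl; intros; ring.
Qed.

Lemma cder_scal (c : C) (f : C -> C) (z a : C) :
  cder f z a -> cder (fun w => c * f w)%C z (c * a)%C.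
Proof.
  intros H; eapply cder_ext; [| |apply (cder_mult _ _ _ _ _ (cder_const c z) H)];
  intros; simpl; ring.
Qed.

Lemma cder_minus (f g : C -> C) (z a b : C) :
  cder f z a -> cder g z b -> cder (fun w => f w - g w)%C z (a - b)%C.
Proof.
  intros Hf Hg.
  eapply cder_ext; [| |apply (cder_plus _ _ _ _ _ Hf (cder_scal (-(1))%C _ _ _ Hg))];
  intros; simpl; ring.
Qed.

Lemma cder_comp (f g : C -> C) (z a b : C) :
  cder f (g z) a -> cder g z b -> cder (fun w => f (g w)) z (a * b)%C.
Proof.
  destruct z as [x y], a as [a1 a2], b as [b1 b2].
  intros Hf [G1 G2]%cder_iff.
  rewrite (surjective_pairing (g (x, y))) in Hf.
  apply cder_iff in Hf; destruct Hf as [F1 F2].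
  apply cder_iff; split.
  - eapply dpl_ext; [| | |apply (differentiable_pt_lim_comp _ _ _ _ _ _ _ _ _ _ _ F1 G1 G2)];
    simpl; intros; try ring; now rewrite <- surjective_pairing.
  - eapply dpl_ext; [| | |apply (differentiable_pt_lim_comp _ _ _ _ _ _ _ _ _ _ _ F2 G1 G2)];
    simpl; intros; try ring; now rewrite <- surjective_pairing.
Qed.

Lemma sum_sqr_neq_0 (z : C) : z <> 0 -> fst z * fst z + snd z * snd z <> 0.
Proof.
  intros H E; apply H; destruct z as [x y]; simpl in E.
  unfold RtoC; f_equal; nra.
Qed.

Lemma cder_Cinv (z : C) : z <> 0 -> cder Cinv z (- / (z * z))%C.
Proof.
  intros Hz; destruct z as [x y].
  assert (N := sum_sqr_neq_0 _ Hz); simpl in N.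
  assert (X := dpl_fst x y); assert (Y := dpl_snd x y).
  assert (D := dpl_plus _ _ _ _ _ _ _ _ (dpl_mult _ _ _ _ _ _ _ _ X X)
     (dpl_mult _ _ _ _ _ _ _ _ Y Y)); simpl in D.
  assert (E : is_derive Rinv (x * x + y * y) (- / (x * x + y * y) ^ 2))
    by (auto_derive; [auto|field; auto]).
  assert (I := dpl_comp1 Rinv (fun u v => u * u + v * v) _ _ _ _ _ E D); simpl in I.
  replace (- / ((x, y) * (x, y)))%C with
    ((y * y - x * x) / (x * x + y * y) ^ 2, 2 * x * y / (x * x + y * y) ^ 2).
  2:{ unfold Cinv, Cmult, Copp; simpl; f_equal; field; split; auto;
      replace ((x * x - y * y) * (x * x - y * y) + (x * y + y * x) * (x * y + y * x))
       with ((x * x + y * y) * (x * x + y * y)) by ring; auto. }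
  apply cder_iff; split.
  - eapply dpl_ext; [| | |apply (dpl_mult _ _ _ _ _ _ _ _ X I)]; simpl.
    + intros; unfold Rdiv; rewrite !Rmult_1_r; reflexivity.
    + field; auto.
    + field; auto.
  - assert (I' := dpl_comp1 (fun t => - t) _ _ _ _ _ (-1)
      ltac:(auto_derive; [auto|ring]) (dpl_mult _ _ _ _ _ _ _ _ Y I)).
    eapply dpl_ext; [| | |apply I']; simpl.
    + intros; unfold Rdiv; rewrite !Rmult_1_r; ring.
    + field; auto.
    + field; auto.
Qed.

Lemma cder_div (f g : C -> C) (z a b : C) :
  g z <> 0 -> cder f z a -> cder g z b ->
  cder (fun w => f w / g w)%C z ((a - (f z / g z) * b) / g z)%C.
Proof.
  intros N Hf Hg.
  eapply cder_ext; [| |apply (cder_mult _ _ _ _ _ Hf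
    (cder_comp _ _ _ _ _ (cder_Cinv _ N) Hg))]; intros; [reflexivity|simpl; field; auto].
Qed.

Lemma cder_curve (f : C -> C) (c1 c2 : R -> R) (t d1 d2 : R) (l : C) :
  cder f (c1 t, c2 t) l -> is_derive c1 t d1 -> is_derive c2 t d2 ->
  is_derive (fun s => Re (f (c1 s, c2 s))) t (Re (l * (d1, d2))%C) /\
  is_derive (fun s => Im (f (c1 s, c2 s))) t (Im (l * (d1, d2))%C).
Proof.
  destruct l as [a b].
  intros [F1 F2]%cder_iff H1 H2.
  apply is_derive_Reals in H1; apply is_derive_Reals in H2.
  assert (K1 := derivable_pt_lim_comp_2d _ _ _ _ _ _ _ _ F1 H1 H2).
  assert (K2 := derivable_pt_lim_comp_2d _ _ _ _ _ _ _ _ F2 H1 H2).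
  apply is_derive_Reals in K1; apply is_derive_Reals in K2.
  split.
  - replace (Re ((a, b) * (d1, d2))%C) with (a * d1 + - b * d2) by (simpl; ring); exact K1.
  - replace (Im ((a, b) * (d1, d2))%C) with (b * d1 + a * d2) by (simpl; ring); exact K2.
Qed.

(** * Bisection of rectangles and compactness of the disc *)

Lemma nested_intervals (a b : nat -> R) :
  (forall n, a n <= a (S n)) -> (forall n, b (S n) <= b n) -> (forall n, a n <= b n) ->
  exists x, forall n, a n <= x <= b n.
Proof.
  intros Ha Hb Hab.
  assert (Ma : forall n k, a n <= a (n + k)%nat).
  { intros n k; induction k as [|k IH]; [rewrite Nat.add_0_r; lra|].
    rewrite Nat.add_succ_r; specialize (Ha (n + k)%nat); lra. }
  assert (Mb : forall n k, b (n + k)%nat <= b n).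
  { intros n k; induction k as [|k IH]; [rewrite Nat.add_0_r; lra|].
    rewrite Nat.add_succ_r; specialize (Hb (n + k)%nat); lra. }
  assert (U : forall n m, a n <= b m).
  { intros n m; specialize (Ma n m); specialize (Mb m n); specialize (Hab (n + m)%nat).
    rewrite Nat.add_comm in Mb; lra. }
  destruct (completeness (fun x => exists n, x = a n)) as [x [X1 X2]].
  - exists (b O); intros x [n ->]; apply U.
  - exists (a O), O; reflexivity.
  - exists x; intros n; split; [apply X1; now exists n|].
    apply X2; intros y [m ->]; apply U.
Qed.

Definition rect : Type := ((R * R) * (R * R))%type.

Definition bad (good : R -> R -> R -> R -> Prop) (s : rect) : Prop :=
  ~ good (fst (fst s)) (snd (fst s)) (fst (snd s)) (snd (snd s)).

(** The fourth quarter is the untested fallback: when the rectangle is bad and the first three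
    quarters are good, the gluing hypothesis of [cousin_rect] makes it bad. *)
Definition bad_quarter (good : R -> R -> R -> R -> Prop) (s : rect) : rect :=
  let a := fst (fst s) in let b := snd (fst s) in
  let c := fst (snd s) in let d := snd (snd s) in
  let m := (a + b) / 2 in let n := (c + d) / 2 in
  if excluded_middle_informative (bad good ((a, m), (c, n))) then ((a, m), (c, n)) else
  if excluded_middle_informative (bad good ((m, b), (c, n))) then ((m, b), (c, n)) else
  if excluded_middle_informative (bad good ((a, m), (n, d))) then ((a, m), (n, d)) else
  ((m, b), (n, d)).

Fixpoint bad_seq (good : R -> R -> R -> R -> Prop) (s : rect) (n : nat) : rect :=
  match n with O => s | S k => bad_quarter good (bad_seq good s k) end.

(** A property that glues from quarters and holds on small rectangles around each point holds
    globally: otherwise bad quarters shrink to a point. This serves both for compactness and for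
    Goursat's subdivision. The proportionality of sides offered to the local hypothesis records that
    only rectangles similar to the original one occur; Goursat needs it to compare diameter squared
    with area. *)
Lemma cousin_rect (good : R -> R -> R -> R -> Prop) (a0 b0 c0 d0 : R) :
  a0 < b0 -> c0 < d0 ->
  (forall a b c d, a0 <= a -> b <= b0 -> c0 <= c -> d <= d0 -> a < b -> c < d ->
     good a ((a + b) / 2) c ((c + d) / 2) -> good ((a + b) / 2) b c ((c + d) / 2) ->
     good a ((a + b) / 2) ((c + d) / 2) d -> good ((a + b) / 2) b ((c + d) / 2) d ->
     good a b c d) ->
  (forall x y, a0 <= x <= b0 -> c0 <= y <= d0 -> exists delta, 0 < delta /\
     forall a b c d, a0 <= a -> b <= b0 -> c0 <= c -> d <= d0 ->
       a <= x <= b -> c <= y <= d -> a < b -> c < d ->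
       b - a < delta -> d - c < delta -> (b - a) * (d0 - c0) = (d - c) * (b0 - a0) ->
       good a b c d) ->
  good a0 b0 c0 d0.
Proof.
  intros Hab Hcd Hq Hl.
  apply NNPP; intros Hbad.
  set (s := bad_seq good ((a0, b0), (c0, d0))).
  set (A := fun n => fst (fst (s n))); set (B := fun n => snd (fst (s n))).
  set (U := fun n => fst (snd (s n))); set (V := fun n => snd (snd (s n))).
  assert (step : forall n, A (S n) = A n /\ B (S n) = (A n + B n) / 2 \/
                           A (S n) = (A n + B n) / 2 /\ B (S n) = B n).
  { intros n; unfold A, B, s; simpl; unfold bad_quarter.
    repeat destruct (excluded_middle_informative _); simpl; auto. }
  assert (step' : forall n, U (S n) = U n /\ V (S n) = (U n + V n) / 2 \/
                           U (S n) = (U n + V n) / 2 /\ V (S n) = V n).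
  { intros n; unfold U, V, s; simpl; unfold bad_quarter.
    repeat destruct (excluded_middle_informative _); simpl; auto. }
  assert (P2 : forall n, 0 < 2 ^ n) by (intros; apply pow_lt; lra).
  assert (inv : forall n, a0 <= A n /\ B n <= b0 /\ c0 <= U n /\ V n <= d0 /\
    B n - A n = (b0 - a0) / 2 ^ n /\ V n - U n = (d0 - c0) / 2 ^ n).
  { intros n; induction n as [|n IH].
    - unfold A, B, U, V, s; simpl; repeat split; lra.
    - destruct IH as (I1 & I2 & I3 & I4 & I5 & I6).
      assert (Hn := P2 n).
      assert (0 < B n - A n) by (rewrite I5; apply Rdiv_lt_0_compat; lra).
      assert (0 < V n - U n) by (rewrite I6; apply Rdiv_lt_0_compat; lra).
      replace ((b0 - a0) / 2 ^ S n) with ((B n - A n) / 2) by (rewrite I5; simpl; field; lra).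
      replace ((d0 - c0) / 2 ^ S n) with ((V n - U n) / 2) by (rewrite I6; simpl; field; lra).
      destruct (step n) as [[-> ->]|[-> ->]]; destruct (step' n) as [[-> ->]|[-> ->]];
      repeat split; lra. }
  assert (pos : forall n, A n < B n /\ U n < V n).
  { intros n; destruct (inv n) as (_ & _ & _ & _ & I5 & I6); specialize (P2 n).
    assert (0 < (b0 - a0) / 2 ^ n) by (apply Rdiv_lt_0_compat; lra).
    assert (0 < (d0 - c0) / 2 ^ n) by (apply Rdiv_lt_0_compat; lra).
    lra. }
  assert (Hb : forall n, bad good (s n)).
  { intros n; induction n as [|n IH]; [exact Hbad|].
    change (bad good (bad_quarter good (s n))); unfold bad_quarter.
    destruct (excluded_middle_informative _) as [|N1]; [assumption|].
    destruct (excluded_middle_informative _) as [|N2]; [assumption|].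
    destruct (excluded_middle_informative _) as [|N3]; [assumption|].
    intros N4; apply IH.
    apply NNPP in N1; apply NNPP in N2; apply NNPP in N3; simpl in *.
    destruct (inv n) as (I1 & I2 & I3 & I4 & _ & _); destruct (pos n).
    now apply Hq. }
  destruct (nested_intervals A B) as [x Hx].
  { intros n; destruct (pos n); destruct (step n) as [[-> _]|[-> _]]; lra. }
  { intros n; destruct (pos n); destruct (step n) as [[_ ->]|[_ ->]]; lra. }
  { intros n; destruct (pos n); lra. }
  destruct (nested_intervals U V) as [y Hy].
  { intros n; destruct (pos n); destruct (step' n) as [[-> _]|[-> _]]; lra. }
  { intros n; destruct (pos n); destruct (step' n) as [[_ ->]|[_ ->]]; lra. }
  { intros n; destruct (pos n); lra. }
  destruct (Hl x y) as [delta [Hd K]].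
  { specialize (Hx O); exact Hx. }
  { specialize (Hy O); exact Hy. }
  (* Halving continues until the sum of the two sides is below [delta], which controls both at
     once. *)
  destruct (pow_lt_1_zero (/ 2) ltac:(rewrite Rabs_pos_eq; lra)
    (delta / ((b0 - a0) + (d0 - c0))) ltac:(apply Rdiv_lt_0_compat; lra)) as [N HN].
  specialize (HN N (le_n N)).
  rewrite Rabs_pos_eq in HN by (apply pow_le; lra).
  rewrite pow_inv in HN.
  assert (HN' : ((b0 - a0) + (d0 - c0)) / 2 ^ N < delta).
  { apply (Rmult_lt_compat_r ((b0 - a0) + (d0 - c0))) in HN; [|lra].
    unfold Rdiv in HN; rewrite Rmult_assoc, Rinv_l in HN by lra.
    unfold Rdiv; lra. }
  assert (HP := P2 N).
  destruct (inv N) as (I1 & I2 & I3 & I4 & I5 & I6); destruct (pos N).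
  assert (0 < (b0 - a0) / 2 ^ N) by (apply Rdiv_lt_0_compat; lra).
  assert (0 < (d0 - c0) / 2 ^ N) by (apply Rdiv_lt_0_compat; lra).
  assert (HS : ((b0 - a0) + (d0 - c0)) / 2 ^ N = (b0 - a0) / 2 ^ N + (d0 - c0) / 2 ^ N)
    by (field; lra).
  apply (Hb N); apply K; fold (A N) (B N) (U N) (V N); auto; try lra.
  rewrite I5, I6; field; lra.
Qed.

Lemma Cmod_in_rect (z w : C) (a b c d : R) :
  a <= fst z <= b -> c <= snd z <= d -> a <= fst w <= b -> c <= snd w <= d ->
  Cmod (w - z)%C <= (b - a) + (d - c).
Proof.
  intros; destruct z as [x y], w as [u v]; simpl in *.
  eapply Rle_trans; [apply (Cmod_le_abs (u - x) (v - y))|].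
  assert (Rabs (u - x) <= b - a) by (apply Rabs_le; lra).
  assert (Rabs (v - y) <= d - c) by (apply Rabs_le; lra).
  lra.
Qed.

Lemma disc_in_square (r : R) (z : C) :
  Cmod z <= r -> - r <= fst z <= r /\ - r <= snd z <= r.
Proof.
  intros H; generalize (Rmax_Cmod z) (Rmax_l (Rabs (fst z)) (Rabs (snd z)))
    (Rmax_r (Rabs (fst z)) (Rabs (snd z))); intros.
  split; apply Rabs_le_between; lra.
Qed.

(** By contradiction: call a rectangle good when one point of the disc strictly beats all points of
    the disc in it. Such a point exists locally because no maximum is attained, four winners reduce
    to the best of them, and a winner for the whole disc would beat itself. *)
Lemma disc_max_exists (r : R) (u : C -> R) :
  0 < r ->
  (forall z, Cmod z <= r -> forall eps, 0 < eps -> exists delta, 0 < delta /\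
     forall w, Cmod w <= r -> Cmod (w - z)%C < delta -> Rabs (u w - u z) < eps) ->
  exists z, Cmod z <= r /\ forall w, Cmod w <= r -> u w <= u z.
Proof.
  intros Hr Hu; apply NNPP; intros N.
  assert (Hn : forall z, Cmod z <= r -> exists w, Cmod w <= r /\ u z < u w).
  { intros z Hz; apply NNPP; intros N'; apply N; exists z; split; auto.
    intros w Hw; apply Rnot_lt_le; intros L; apply N'; now exists w. }
  assert (G : exists z, Cmod z <= r /\ forall w, Cmod w <= r ->
     - r <= fst w <= r -> - r <= snd w <= r -> u w < u z).
  { apply (cousin_rect (fun a b c d => exists z, Cmod z <= r /\ forall w, Cmod w <= r ->
     a <= fst w <= b -> c <= snd w <= d -> u w < u z)); try lra.
    - intros a b c d _ _ _ _ Hab Hcd [z1 [Z1 G1]] [z2 [Z2 G2]] [z3 [Z3 G3]] [z4 [Z4 G4]].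
      assert (M : exists z, Cmod z <= r /\ u z1 <= u z /\ u z2 <= u z /\ u z3 <= u z /\ u z4 <= u z).
      { assert (M2 : forall p q, Cmod p <= r -> Cmod q <= r ->
          exists z, Cmod z <= r /\ u p <= u z /\ u q <= u z).
        { intros p q Hp Hq; destruct (Rle_lt_dec (u p) (u q)); [exists q|exists p]; lra. }
        destruct (M2 z1 z2 Z1 Z2) as [p [Hp [? ?]]].
        destruct (M2 z3 z4 Z3 Z4) as [q [Hq [? ?]]].
        destruct (M2 p q Hp Hq) as [z [Hz [? ?]]].
        exists z; lra. }
      destruct M as [z [Hz M]]; exists z; split; auto.
      intros w Hw Hf Hs.
      destruct (Rle_lt_dec (fst w) ((a + b) / 2)); destruct (Rle_lt_dec (snd w) ((c + d) / 2)).
      + specialize (G1 w Hw ltac:(lra) ltac:(lra)); lra.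
      + specialize (G3 w Hw ltac:(lra) ltac:(lra)); lra.
      + specialize (G2 w Hw ltac:(lra) ltac:(lra)); lra.
      + specialize (G4 w Hw ltac:(lra) ltac:(lra)); lra.
    - intros x y Hx Hy; destruct (Rle_lt_dec (Cmod (x, y)) r) as [Hz|Hz].
      + destruct (Hn _ Hz) as [w0 [Hw0 L]].
        destruct (Hu _ Hz (u w0 - u (x, y)) ltac:(lra)) as [delta [Hd K]].
        exists (delta / 2); split; [lra|]; intros a b c d _ _ _ _ Ha Hc Hab Hcd D1 D2 _.
        exists w0; split; auto; intros w Hw W1 W2.
        assert (Hm := Cmod_in_rect (x, y) w a b c d Ha Hc W1 W2).
        specialize (K w Hw ltac:(lra)); apply Rabs_def2 in K; lra.
      (* A small rectangle around a point outside the disc misses the disc, so any witness will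
         do. *)
      + exists ((Cmod (x, y) - r) / 2); split; [lra|]; intros a b c d _ _ _ _ Ha Hc Hab Hcd D1 D2 _.
        exists 0; rewrite Cmod_0; split; [lra|]; intros w Hw W1 W2; exfalso.
        assert (Hm := Cmod_in_rect (x, y) w a b c d Ha Hc W1 W2).
        generalize (Cmod_triangle_sub (x, y) w); rewrite Cmod_minus_sym; lra. }
  destruct G as [z [Hz G]].
  destruct (disc_in_square _ _ Hz).
  specialize (G z Hz ltac:(lra) ltac:(lra)); lra.
Qed.

(** Uniform continuity measured against the size of f: for close points f w / f z lies within 1/2 of
    1, where [clog] is available. *)
Lemma disc_uniformly_close (r : R) (f : C -> C) :
  0 < r -> (forall z, Cmod z <= r -> ccont f z /\ f z <> 0) ->
  exists delta, 0 < delta /\ forall z w, Cmod z <= r -> Cmod w <= r -> Cmod (w - z)%C < delta ->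
    Cmod (f w - f z)%C < Cmod (f z) / 2.
Proof.
  intros Hr Hf.
  assert (G : exists delta, 0 < delta /\ forall z w, Cmod z <= r -> Cmod w <= r ->
     - r <= fst z <= r -> - r <= snd z <= r -> Cmod (w - z)%C < delta ->
    Cmod (f w - f z)%C < Cmod (f z) / 2).
  { apply (cousin_rect (fun a b c d => exists delta, 0 < delta /\ forall z w,
     Cmod z <= r -> Cmod w <= r ->
     a <= fst z <= b -> c <= snd z <= d -> Cmod (w - z)%C < delta ->
     Cmod (f w - f z)%C < Cmod (f z) / 2)); try lra.
    - intros a b c d _ _ _ _ Hab Hcd [d1 [D1 G1]] [d2 [D2 G2]] [d3 [D3 G3]] [d4 [D4 G4]].
      exists (Rmin (Rmin d1 d2) (Rmin d3 d4)); split; [now repeat apply Rmin_pos|].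
      intros z w Hz Hw H1 H2 Hm.
      generalize (Rmin_l (Rmin d1 d2) (Rmin d3 d4)) (Rmin_r (Rmin d1 d2) (Rmin d3 d4))
        (Rmin_l d1 d2) (Rmin_r d1 d2) (Rmin_l d3 d4) (Rmin_r d3 d4); intros.
      destruct (Rle_lt_dec (fst z) ((a + b) / 2)); destruct (Rle_lt_dec (snd z) ((c + d) / 2)).
      + apply G1; auto; lra.
      + apply G3; auto; lra.
      + apply G2; auto; lra.
      + apply G4; auto; lra.
    - intros x y Hx Hy; destruct (Rle_lt_dec (Cmod (x, y)) r) as [Hz|Hz].
      + destruct (Hf _ Hz) as [Hc N]; apply Cmod_gt_0 in N.
        (* Two values within 1/8 of |f(x, y)| from the central one differ by less than 1/4 of it,
           while |f z| exceeds 7/8 of it; and 1/4 < 7/16. *)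
        destruct (Hc (Cmod (f (x, y)) / 8) ltac:(lra)) as [delta [Hd K]].
        exists (delta / 4); split; [lra|]; intros a b c d _ _ _ _ Ha Hc' Hab Hcd D1 D2 _.
        exists (delta / 2); split; [lra|]; intros z w Hz' Hw W1 W2 Hm.
        assert (Hm1 := Cmod_in_rect (x, y) z a b c d Ha Hc' W1 W2).
        assert (Hm2 : Cmod (w - (x, y))%C < delta).
        { replace (w - (x, y))%C with ((w - z) + (z - (x, y)))%C by ring.
          eapply Rle_lt_trans; [apply Cmod_triangle|]; lra. }
        assert (K1 := K z ltac:(lra)); assert (K2 := K w Hm2).
        replace (f w - f z)%C with ((f w - f (x, y)) - (f z - f (x, y)))%C by ring.
        generalize (Cmod_triangle (f w - f (x, y))%C (- (f z - f (x, y)))%C); rewrite Cmod_opp.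
        generalize (Cmod_triangle_sub (f (x, y)) (f z)); rewrite Cmod_minus_sym.
        unfold Cminus at 6; lra.
      + exists ((Cmod (x, y) - r) / 2); split; [lra|]; intros a b c d _ _ _ _ Ha Hc Hab Hcd D1 D2 _.
        exists 1; split; [lra|]; intros z w Hz' Hw W1 W2; exfalso.
        assert (Hm := Cmod_in_rect (x, y) z a b c d Ha Hc W1 W2).
        generalize (Cmod_triangle_sub (x, y) z); rewrite Cmod_minus_sym; lra. }
  destruct G as [delta [Hd G]]; exists delta; split; auto.
  intros z w Hz Hw; destruct (disc_in_square _ _ Hz); now apply G.
Qed.

(** * Goursat's lemma and the mean over circles *)

Lemma dpl_continuous (f : R -> R -> R) x y a b :
  differentiable_pt_lim f x y a b ->
  continuous (fun u => f u y) x /\ continuous (fun v => f x v) y.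
Proof.
  intros H; split.
  - apply (ex_derive_continuous (V := R_NormedModule)); exists a.
    apply is_derive_Reals.
    replace a with (a * 1 + b * 0) by ring.
    apply (derivable_pt_lim_comp_2d f (fun u => u) (fun _ => y) x a b 1 0); auto.
    apply derivable_pt_lim_id. apply derivable_pt_lim_const.
  - apply (ex_derive_continuous (V := R_NormedModule)); exists b.
    apply is_derive_Reals.
    replace b with (a * 0 + b * 1) by ring.
    apply (derivable_pt_lim_comp_2d f (fun _ => x) (fun u => u) y a b 0 1); auto.
    apply derivable_pt_lim_const. apply derivable_pt_lim_id.
Qed.

Lemma RInt_near_const (f : R -> R) (a b k e : R) :
  a <= b -> (forall t, a <= t <= b -> continuous f t) ->
  (forall t, a <= t <= b -> Rabs (f t - k) <= e) ->
  Rabs (RInt f a b - k * (b - a)) <= (b - a) * e.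
Proof.
  intros Hab Hc Hf.
  assert (Ef : ex_RInt f a b).
  { apply (ex_RInt_continuous (V := R_CompleteNormedModule)); intros t.
    rewrite Rmin_left, Rmax_right by lra; apply Hc. }
  assert (Ek : ex_RInt (fun _ => k) a b) by apply ex_RInt_const.
  replace (RInt f a b - k * (b - a)) with (RInt (fun t => f t - k) a b).
  - apply abs_RInt_le_const; auto.
    apply (ex_RInt_minus (V := R_NormedModule)); auto.
  - rewrite (RInt_minus (V := R_CompleteNormedModule) f (fun _ => k)) by auto.
    rewrite RInt_const; unfold minus, plus, opp, scal; simpl; unfold mult; simpl; ring.
Qed.

Lemma le_all_eps (x k : R) : 0 <= k -> (forall eps, 0 < eps -> x <= eps * k) -> x <= 0.
Proof.
  intros Hk H; apply Rnot_lt_le; intros Hx.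
  specialize (H (x / (2 * (k + 1))) ltac:(apply Rdiv_lt_0_compat; lra)).
  assert (x / (2 * (k + 1)) * k < x); [|lra].
  apply (Rmult_lt_reg_r (2 * (k + 1))); [lra|].
  replace (x / (2 * (k + 1)) * k * (2 * (k + 1))) with (x * k) by (field; lra).
  nra.
Qed.

(* Goursat's subdivision argument needs only the one Cauchy-Riemann equation
   P_x = Q_y, and no continuity of the derivatives. *)
Lemma goursat_rect (P Q : R -> R -> R) (a0 b0 c0 d0 : R) :
  a0 < b0 -> c0 < d0 ->
  (forall x y, a0 <= x <= b0 -> c0 <= y <= d0 -> exists px py qx,
     differentiable_pt_lim P x y px py /\ differentiable_pt_lim Q x y qx px) ->
  RInt (fun y => P b0 y) c0 d0 - RInt (fun y => P a0 y) c0 d0 =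
  RInt (fun x => Q x d0) a0 b0 - RInt (fun x => Q x c0) a0 b0.
Proof.
  intros Hab Hcd HPQ.
  set (J := fun a b c d => RInt (fun y => P b y) c d - RInt (fun y => P a y) c d -
    (RInt (fun x => Q x d) a b - RInt (fun x => Q x c) a b)).
  enough (HJ : Rabs (J a0 b0 c0 d0) <= 0).
  { assert (E : J a0 b0 c0 d0 = 0).
    { generalize (Rabs_pos (J a0 b0 c0 d0)) (Rle_abs (J a0 b0 c0 d0))
        (Rle_abs (- J a0 b0 c0 d0)); rewrite Rabs_Ropp; lra. }
    unfold J in E; lra. }
  assert (CP : forall x y, a0 <= x <= b0 -> c0 <= y <= d0 -> continuous (fun v => P x v) y).
  { intros x y Hx Hy; destruct (HPQ x y Hx Hy) as (px & py & qx & H & _).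
    apply (dpl_continuous _ _ _ _ _ H). }
  assert (CQ : forall x y, a0 <= x <= b0 -> c0 <= y <= d0 -> continuous (fun u => Q u y) x).
  { intros x y Hx Hy; destruct (HPQ x y Hx Hy) as (px & py & qx & _ & H).
    apply (dpl_continuous _ _ _ _ _ H). }
  assert (EP : forall x c d, a0 <= x <= b0 -> c0 <= c -> c <= d -> d <= d0 ->
     ex_RInt (fun v => P x v) c d).
  { intros x c d Hx Hc Hc' Hd; apply (ex_RInt_continuous (V := R_CompleteNormedModule)).
    intros v; rewrite Rmin_left, Rmax_right by lra; intros; apply CP; lra. }
  assert (EQ : forall y a b, c0 <= y <= d0 -> a0 <= a -> a <= b -> b <= b0 ->
     ex_RInt (fun u => Q u y) a b).
  { intros y a b Hy Ha Ha' Hb; apply (ex_RInt_continuous (V := R_CompleteNormedModule)).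
    intros v; rewrite Rmin_left, Rmax_right by lra; intros; apply CQ; lra. }
  apply (le_all_eps _ ((b0 - a0) * (d0 - c0))).
  { apply Rmult_le_pos; lra. }
  intros eps Heps.
  (* The defect [J] is additive under quartering, and so is the bound eps times area. *)
  apply (cousin_rect (fun a b c d => Rabs (J a b c d) <= eps * ((b - a) * (d - c)))); auto.
  - intros a b c d Ha Hb Hc Hd Hab' Hcd'.
    set (m := (a + b) / 2); set (n := (c + d) / 2).
    intros G1 G2 G3 G4.
    assert (Hm : a < m < b) by (unfold m; lra).
    assert (Hn : c < n < d) by (unfold n; lra).
    assert (SP : forall x, a0 <= x <= b0 -> RInt (fun v => P x v) c d =
       RInt (fun v => P x v) c n + RInt (fun v => P x v) n d).
    { intros x Hx; symmetry; apply (RInt_Chasles (V := R_CompleteNormedModule)); apply EP; lra. }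
    assert (SQ : forall y, c0 <= y <= d0 -> RInt (fun v => Q v y) a b =
       RInt (fun v => Q v y) a m + RInt (fun v => Q v y) m b).
    { intros y Hy; symmetry; apply (RInt_Chasles (V := R_CompleteNormedModule)); apply EQ; lra. }
    replace (J a b c d) with ((J a m c n + J m b c n) + (J a m n d + J m b n d)).
    2:{ unfold J; rewrite (SP a), (SP b), (SQ c), (SQ d) by lra; ring. }
    eapply Rle_trans; [apply Rabs_triang|].
    generalize (Rabs_triang (J a m c n) (J m b c n)) (Rabs_triang (J a m n d) (J m b n d)).
    replace (eps * ((b - a) * (d - c))) with
      (eps * ((m - a) * (n - c)) + eps * ((b - m) * (n - c)) +
       (eps * ((m - a) * (d - n)) + eps * ((b - m) * (d - n)))) by ring.
    lra.
  - intros x y Hx Hy.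
    destruct (HPQ x y Hx Hy) as (px & py & qx & HP & HQ).
    set (W := b0 - a0); set (T := d0 - c0).
    assert (HW : 0 < W) by (unfold W; lra).
    assert (HT : 0 < T) by (unfold T; lra).
    (* [K] is the square of the sum of the sides divided by the area, the same for all similar
       rectangles. The errors below add up to 2 [e] times that square, which is [eps] times the
       area. *)
    set (K := (W + T) * (W + T) / (W * T)).
    assert (HK : 0 < K) by (apply Rdiv_lt_0_compat; nra).
    assert (He : 0 < eps / (2 * K)) by (apply Rdiv_lt_0_compat; lra).
    destruct (HP (mkposreal _ He)) as [d1 K1]; destruct (HQ (mkposreal _ He)) as [d2 K2].
    simpl in K1, K2.
    exists (Rmin d1 d2); split; [apply Rmin_pos; [apply d1|apply d2]|].
    intros a b c d Ha Hb Hc Hd Hxa Hyc Hab' Hcd' D1 D2 HR.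
    generalize (Rmin_l d1 d2) (Rmin_r d1 d2); intros M1 M2.
    set (s := (b - a) + (d - c)).
    set (e := eps / (2 * K)) in *.
    assert (Bd : forall u v, a <= u <= b -> c <= v <= d ->
      Rabs (P u v - P x y - (px * (u - x) + py * (v - y))) <= e * s /\
      Rabs (Q u v - Q x y - (qx * (u - x) + px * (v - y))) <= e * s).
    { intros u v Hu Hv.
      assert (A1 : Rabs (u - x) <= b - a) by (apply Rabs_le; lra).
      assert (A2 : Rabs (v - y) <= d - c) by (apply Rabs_le; lra).
      assert (A3 : Rmax (Rabs (u - x)) (Rabs (v - y)) <= s)
        by (unfold s; apply Rmax_lub; lra).
      split; (eapply Rle_trans; [first [apply K1|apply K2]; lra|]);
      apply Rmult_le_compat_l; lra. }
    assert (R2 : forall u v, Rabs (u - v) <= Rabs u + Rabs v).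
    { intros u v; generalize (Rabs_triang u (- v)); rewrite Rabs_Ropp; unfold Rminus; auto. }
    (* Subtracting opposite sides first leaves px times the area as main term of both integrals,
       because P_x = Q_y = px at the point; these terms cancel in [J]. *)
    assert (I1 : Rabs (RInt (fun v => P b v - P a v) c d - px * (b - a) * (d - c))
       <= (d - c) * (2 * (e * s))).
    { apply RInt_near_const; [lra| |].
      - intros v Hv; apply (continuous_minus (V := R_NormedModule)); apply CP; lra.
      - intros v Hv.
        destruct (Bd b v ltac:(lra) Hv) as [B1 _]; destruct (Bd a v ltac:(lra) Hv) as [B2 _].
        match type of B1 with Rabs ?p <= _ => match type of B2 with Rabs ?q <= _ =>
          generalize (R2 p q); replace (p - q) with (P b v - P a v - px * (b - a)) by ring end end.
        lra. }
    assert (I2 : Rabs (RInt (fun u => Q u d - Q u c) a b - px * (d - c) * (b - a))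
       <= (b - a) * (2 * (e * s))).
    { apply RInt_near_const; [lra| |].
      - intros v Hv; apply (continuous_minus (V := R_NormedModule)); apply CQ; lra.
      - intros v Hv.
        destruct (Bd v d Hv ltac:(lra)) as [_ B1]; destruct (Bd v c Hv ltac:(lra)) as [_ B2].
        match type of B1 with Rabs ?p <= _ => match type of B2 with Rabs ?q <= _ =>
          generalize (R2 p q); replace (p - q) with (Q v d - Q v c - px * (d - c)) by ring end end.
        lra. }
    assert (E1 : RInt (fun v => P b v - P a v) c d =
       RInt (fun v => P b v) c d - RInt (fun v => P a v) c d).
    { apply (RInt_minus (V := R_CompleteNormedModule)); apply EP; lra. }
    assert (E2 : RInt (fun u => Q u d - Q u c) a b =
       RInt (fun u => Q u d) a b - RInt (fun u => Q u c) a b).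
    { apply (RInt_minus (V := R_CompleteNormedModule)); apply EQ; lra. }
    rewrite E1 in I1; rewrite E2 in I2.
    apply Rle_trans with (s * (2 * (e * s))).
    + match type of I1 with Rabs ?p <= _ => match type of I2 with Rabs ?q <= _ =>
        generalize (R2 p q); replace (p - q) with (J a b c d) by (unfold J; ring) end end.
      replace (s * (2 * (e * s))) with ((d - c) * (2 * (e * s)) + (b - a) * (2 * (e * s)))
        by (unfold s; ring).
      lra.
    + apply Req_le; fold T W in HR; unfold e.
      assert (ED : d - c = (b - a) * T / W) by (rewrite HR; field; lra).
      unfold s; rewrite ED; unfold K; field; repeat split; nra.
Qed.

Lemma exp_polar_dpl (x y : R) :
  differentiable_pt_lim (fun u v => exp u * cos v) x y (exp x * cos y) (- (exp x * sin y)) /\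
  differentiable_pt_lim (fun u v => exp u * sin v) x y (exp x * sin y) (exp x * cos y).
Proof.
  assert (E := dpl_comp1 exp _ _ _ _ _ _ (is_derive_exp x) (dpl_fst x y)).
  assert (Dc : is_derive cos y (- sin y)) by (apply is_derive_Reals, derivable_pt_lim_cos).
  assert (Ds : is_derive sin y (cos y)) by (apply is_derive_Reals, derivable_pt_lim_sin).
  assert (Ec := dpl_comp1 cos (fun _ v => v) x y _ _ _ Dc (dpl_snd x y)).
  assert (Es := dpl_comp1 sin (fun _ v => v) x y _ _ _ Ds (dpl_snd x y)).
  split; [eapply dpl_ext; [| | |apply (dpl_mult _ _ _ _ _ _ _ _ E Ec)]
         |eapply dpl_ext; [| | |apply (dpl_mult _ _ _ _ _ _ _ _ E Es)]];
  simpl; intros; ring.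
Qed.

Lemma Cmod_polar (r t : R) : 0 <= r -> Cmod (r * cos t, r * sin t) = r.
Proof.
  intros Hr; unfold Cmod; simpl.
  replace (r * cos t * (r * cos t * 1) + r * sin t * (r * sin t * 1)) with (r * r).
  - now apply sqrt_square.
  - generalize (sin2_cos2 t); unfold Rsqr; intros H.
    transitivity (r * r * (sin t * sin t + cos t * cos t)); [rewrite H|]; ring.
Qed.

(* The mean of [Re G] over circles |z| = e^x does not depend on x, by Goursat's
   lemma in the coordinates z = e^(x+iy) and 2pi-periodicity in y. *)
Lemma Re_nonneg_at_center (G : C -> C) (rho : R) :
  0 < rho ->
  (forall z, 0 < Cmod z <= rho -> exists l, cder G z l) ->
  ccont G 0 ->
  (forall z, Cmod z = rho -> 0 <= Re (G z)) -> 0 <= Re (G 0).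
Proof.
  intros Hrho HG HG0 Hpos; apply Rnot_lt_le; intros Hneg.
  set (P := fun x y => fst (G (exp x * cos y, exp x * sin y))).
  set (Q := fun x y => snd (G (exp x * cos y, exp x * sin y))).
  destruct (HG0 (- Re (G 0) / 2) ltac:(lra)) as [d [Hd K]].
  (* The circle of radius e^x0 lies where G is within -Re(G 0)/2 of G 0, so Re G is negative on it.
     The second argument of the minimum ensures x0 < x1. *)
  set (x1 := ln rho); set (x0 := Rmin (ln (d / 2)) (ln rho - 1)).
  assert (Hx : x0 < x1) by (unfold x0, x1; generalize (Rmin_r (ln (d / 2)) (ln rho - 1)); lra).
  assert (Hx0 : exp x0 < d).
  { apply Rle_lt_trans with (d / 2); [|lra].
    rewrite <- (exp_ln (d / 2)) by lra.
    destruct (Rle_lt_or_eq_dec x0 (ln (d / 2)) (Rmin_l _ _)) as [L|L];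
    [apply Rlt_le, exp_increasing, L|rewrite L; lra]. }
  assert (D : forall x y, x0 <= x <= x1 -> exists px py qx,
     differentiable_pt_lim P x y px py /\ differentiable_pt_lim Q x y qx px).
  { intros x y Hxx.
    destruct (HG (exp x * cos y, exp x * sin y)) as [[l1 l2] L].
    { rewrite Cmod_polar by apply Rlt_le, exp_pos; split; [apply exp_pos|].
      rewrite <- (exp_ln rho) by lra.
      destruct (Rle_lt_or_eq_dec x x1 (proj2 Hxx)) as [L|L];
      [apply Rlt_le, exp_increasing, L|rewrite L; unfold x1; lra]. }
    apply cder_iff in L; destruct L as [L1 L2].
    destruct (exp_polar_dpl x y) as [X Y].
    assert (DP := differentiable_pt_lim_comp _ _ _ _ _ _ _ _ _ _ _ L1 X Y).
    assert (DQ := differentiable_pt_lim_comp _ _ _ _ _ _ _ _ _ _ _ L2 X Y).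
    do 3 eexists; split; [exact DP|].
    eapply dpl_ext; [| | |exact DQ]; [reflexivity|reflexivity|ring]. }
  assert (HPI := PI_RGT_0).
  assert (E := goursat_rect P Q x0 x1 0 (2 * PI) Hx ltac:(lra) (fun x y Hxx _ => D x y Hxx)).
  assert (EQ : RInt (fun x => Q x (2 * PI)) x0 x1 = RInt (fun x => Q x 0) x0 x1).
  { apply RInt_ext; intros x _; unfold Q; now rewrite cos_2PI, sin_2PI, cos_0, sin_0. }
  rewrite EQ in E.
  assert (CP : forall x, x0 <= x <= x1 -> forall y, continuous (fun v => P x v) y).
  { intros x Hxx y; destruct (D x y Hxx) as (px & py & qx & H & _).
    apply (dpl_continuous _ _ _ _ _ H). }
  assert (EX : forall x, x0 <= x <= x1 -> ex_RInt (fun v => P x v) 0 (2 * PI)).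
  { intros x Hxx; apply (ex_RInt_continuous (V := R_CompleteNormedModule)); intros; now apply CP. }
  assert (I1 : 0 <= RInt (fun y => P x1 y) 0 (2 * PI)).
  { apply RInt_ge_0; [lra|apply EX; lra|]; intros y _; apply Hpos.
    unfold x1; rewrite exp_ln by lra; apply Cmod_polar; lra. }
  assert (I0 : RInt (fun y => P x0 y) 0 (2 * PI) < RInt (fun _ => 0) 0 (2 * PI)).
  { apply RInt_lt; [lra| | |].
    - intros; apply continuous_const.
    - intros y _; apply CP; lra.
    - intros y _.
      specialize (K (exp x0 * cos y, exp x0 * sin y)).
      match type of K with _ -> ?k =>
        assert (K' : k) end.
      { apply K.
        rewrite Cminus_0_r.
        rewrite Cmod_polar by apply Rlt_le, exp_pos; auto. }
      match type of K' with Cmod ?w < _ => generalize (Re_le_Cmod w) end.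
      unfold P, Cminus in *; rewrite re_plus, re_opp; change (@fst R R) with Re.
      set (p := G (exp x0 * cos y, exp x0 * sin y)) in *; set (q := G 0) in *.
      clearbody p q; clear - Hneg K'; simpl; intros; lra. }
  rewrite RInt_const in I0; unfold scal in I0; simpl in I0; unfold mult in I0; simpl in I0.
  lra.
Qed.

(** * Difference quotients and Harnack's inequality *)

Lemma ccont_plus (f g : C -> C) (z : C) :
  ccont f z -> ccont g z -> ccont (fun w => f w + g w)%C z.
Proof.
  intros Hf Hg eps Heps.
  destruct (Hf (eps / 2) ltac:(lra)) as [d1 [D1 K1]].
  destruct (Hg (eps / 2) ltac:(lra)) as [d2 [D2 K2]].
  exists (Rmin d1 d2); split; [now apply Rmin_pos|]; intros w Hw.
  generalize (Rmin_l d1 d2) (Rmin_r d1 d2); intros.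
  specialize (K1 w ltac:(lra)); specialize (K2 w ltac:(lra)).
  replace (f w + g w - (f z + g z))%C with ((f w - f z) + (g w - g z))%C by ring.
  eapply Rle_lt_trans; [apply Cmod_triangle|lra].
Qed.

Lemma ccont_mult (f g : C -> C) (z : C) :
  ccont f z -> ccont g z -> ccont (fun w => f w * g w)%C z.
Proof.
  intros Hf Hg eps Heps.
  set (M := Cmod (f z) + Cmod (g z) + 1).
  assert (F0 := Cmod_ge_0 (f z)); assert (G0 := Cmod_ge_0 (g z)).
  assert (HM : 1 <= M) by (unfold M; lra).
  set (e := Rmin 1 (eps / (2 * M))).
  assert (Q : 0 < eps / (2 * M)) by (apply Rdiv_lt_0_compat; lra).
  assert (He : 0 < e) by (apply Rmin_pos; lra).
  assert (He1 : e <= 1) by apply Rmin_l.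
  assert (He2 : e * (2 * M) <= eps).
  { apply Rle_trans with (eps / (2 * M) * (2 * M)).
    - apply Rmult_le_compat_r; [lra|apply Rmin_r].
    - apply Req_le; field; lra. }
  destruct (Hf e He) as [d1 [D1 K1]].
  destruct (Hg e He) as [d2 [D2 K2]].
  exists (Rmin d1 d2); split; [now apply Rmin_pos|]; intros w Hw.
  generalize (Rmin_l d1 d2) (Rmin_r d1 d2); intros.
  specialize (K1 w ltac:(lra)); specialize (K2 w ltac:(lra)).
  replace (f w * g w - f z * g z)%C with
    ((f w - f z) * (g w - g z) + ((f w - f z) * g z + f z * (g w - g z)))%C by ring.
  eapply Rle_lt_trans; [apply Cmod_triangle|].
  eapply Rle_lt_trans; [apply Rplus_le_compat_l, Cmod_triangle|].
  rewrite !Cmod_mult.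
  assert (A := Cmod_ge_0 (f w - f z)%C); assert (B := Cmod_ge_0 (g w - g z)%C).
  unfold M in *; nra.
Qed.

Lemma ccont_comp (f g : C -> C) (z : C) :
  ccont f (g z) -> ccont g z -> ccont (fun w => f (g w)) z.
Proof.
  intros Hf Hg eps Heps.
  destruct (Hf eps Heps) as [d1 [D1 K1]].
  destruct (Hg d1 D1) as [d2 [D2 K2]].
  exists d2; split; auto.
Qed.

Lemma ccont_div (f g : C -> C) (z : C) :
  g z <> 0 -> ccont f z -> ccont g z -> ccont (fun w => f w / g w)%C z.
Proof.
  intros N Hf Hg; apply ccont_mult; auto.
  apply (ccont_comp Cinv g); auto.
  eapply cder_ccont, cder_Cinv, N.
Qed.

(** The difference quotient with its singularity filled in by hand. It is continuous at b and
    complex differentiable elsewhere, which is exactly what [Re_nonneg_at_center] accepts, so no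
    removable singularity theorem is called for. *)
Definition slope (f : C -> C) (b l z : C) : C :=
  if Ceq_dec z b then l else ((f z - f b) / (z - b))%C.

Lemma slope_eq (f : C -> C) (b l z : C) :
  z <> b -> slope f b l z = ((f z - f b) / (z - b))%C.
Proof. unfold slope; destruct (Ceq_dec z b); tauto. Qed.

Lemma slope_base (f : C -> C) (b l : C) : slope f b l b = l.
Proof. unfold slope; destruct (Ceq_dec b b); tauto. Qed.

Lemma slope_ccont (f : C -> C) (b l : C) : cder f b l -> ccont (slope f b l) b.
Proof.
  intros H eps Heps.
  destruct (H (eps / 2) ltac:(lra)) as [d [D K]].
  exists d; split; auto; intros w Hw.
  rewrite slope_base.
  destruct (Ceq_dec w b) as [->|N].
  { rewrite slope_base; replace (l - l)%C with (RtoC 0) by ring; rewrite Cmod_0; lra. }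
  rewrite slope_eq by auto.
  specialize (K w Hw).
  assert (N' := Cminus_neq_0 _ _ N).
  assert (P := proj1 (Cmod_gt_0 _) N').
  replace ((f w - f b) / (w - b) - l)%C with ((f w - f b - l * (w - b)) / (w - b))%C
    by (field; auto).
  rewrite Cmod_div by auto.
  apply Rle_lt_trans with (eps / 2); [|lra].
  apply (Rmult_le_reg_r (Cmod (w - b)%C)); auto.
  unfold Rdiv at 1; rewrite Rmult_assoc, Rinv_l by lra; lra.
Qed.

Lemma slope_cder (f : C -> C) (b l z d : C) :
  z <> b -> cder f z d ->
  cder (slope f b l) z ((d - (f z - f b) / (z - b)) / (z - b))%C.
Proof.
  intros N H.
  assert (N' := Cminus_neq_0 _ _ N).
  eapply (cder_ext_loc (fun w => (f w - f b) / (w - b))%C _ z _ _ (Cmod (z - b)%C)).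
  - now apply Cmod_gt_0.
  - intros w Hw; rewrite slope_eq; auto.
    intros ->; rewrite Cmod_minus_sym in Hw; lra.
  - reflexivity.
  - eapply cder_ext; [reflexivity| |apply cder_div; [exact N'
      |exact (cder_minus _ _ _ _ _ H (cder_const (f b) z))
      |exact (cder_minus _ _ _ _ _ (cder_id z) (cder_const b z))]].
    simpl; field; auto.
Qed.

Lemma increasing_of_derive (f df : R -> R) (a b : R) :
  a <= b -> (forall x, a <= x <= b -> is_derive f x (df x)) ->
  (forall x, a < x < b -> 0 <= df x) -> f a <= f b.
Proof.
  intros Hab Hd Hp.
  destruct (Rle_lt_or_eq_dec _ _ Hab) as [L|<-]; [|lra].
  destruct (MVT_cor2 f df a b L) as [c [E Hc]].
  - intros x Hx; now apply is_derive_Reals, Hd.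
  - specialize (Hp c Hc); nra.
Qed.

Lemma strictly_increasing_of_derive (f df : R -> R) (a b : R) :
  a < b -> (forall x, a <= x <= b -> is_derive f x (df x)) ->
  (forall x, a < x < b -> 0 < df x) -> f a < f b.
Proof.
  intros Hab Hd Hp.
  destruct (MVT_cor2 f df a b Hab) as [c [E Hc]].
  - intros x Hx; now apply is_derive_Reals, Hd.
  - specialize (Hp c Hc); nra.
Qed.

(** On the unit circle 1/w is the conjugate of w, so the two numbers are conjugate to each other. *)
Lemma Re_mult_conj_inv (z w : C) : Cmod w = 1 -> Re (z / w)%C = Re (Cconj z * w)%C.
Proof.
  intros H; assert (S := Cmod_sqr w); rewrite H in S.
  destruct z as [x y], w as [u v]; unfold Cdiv, Cinv; simpl in *.
  replace (u * (u * 1) + v * (v * 1)) with 1 by lra; field.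
Qed.

(** Re F is tested against the nonnegative kernel 2 + 2 cos on the circle of radius rho, whose mean
    picks out 2 F(0) and rho l. With w = z/rho the kernel produces the term F/w; its pole is removed
    by subtracting F(0)/w, and adding conj(F(0)) w restores the real part on the circle. *)
Lemma center_gradient_rho (F : C -> C) (l : C) (rho : R) :
  0 < rho < 1 ->
  (forall z, Cmod z < 1 -> exists d, cder F z d) -> cder F 0 l ->
  (forall z, Cmod z < 1 -> 0 <= Re (F z)) ->
  0 <= 2 * Re (F 0) + rho * Re l.
Proof.
  intros Hrho HF Hl Hpos.
  set (c := RtoC (/ rho)).
  assert (Nr : RtoC rho <> 0) by (intros E; apply (f_equal fst) in E; simpl in E; lra).
  assert (Ec : c = (/ RtoC rho)%C) by (unfold c; rewrite RtoC_inv; auto; lra).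
  (* chosen so that Re G = Re F * (2 + 2 Re (c z)) >= 0 on |z| = rho, where |c z| = 1 *)
  set (G := fun z => (2 * F z + F z * (c * z) + rho * slope F 0 l z + Cconj (F 0) * (c * z))%C).
  assert (H0 : 0 <= Re (G 0)).
  { apply (Re_nonneg_at_center G rho); [lra| | |].
    - intros z Hz; assert (Nz := Cmod_neq_0 z ltac:(lra)).
      destruct (HF z ltac:(lra)) as [d Hd].
      eexists; unfold G.
      repeat first [apply cder_plus|apply cder_scal|apply cder_mult|apply cder_id|
        apply slope_cder|exact Hd|exact Nz].
    - unfold G; repeat first [apply ccont_plus|apply ccont_mult|apply slope_ccont; exact Hl
        |eapply cder_ccont; first [apply cder_const|apply cder_id|exact Hl]].
    - intros z Hz; assert (Nz := Cmod_neq_0 z ltac:(lra)).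
      assert (Hw : Cmod (c * z)%C = 1).
      { rewrite Cmod_mult; unfold c; rewrite Cmod_R, Rabs_pos_eq, Hz.
        apply Rinv_l; lra. apply Rlt_le, Rinv_0_lt_compat; lra. }
      unfold G; rewrite slope_eq by auto.
      set (w := (c * z)%C) in *.
      replace (rho * ((F z - F 0) / (z - 0)))%C with (F z / w - F 0 / w)%C.
      2:{ unfold w; rewrite Ec; field; repeat split; auto; rewrite Cminus_0_r; auto. }
      unfold Cminus; rewrite !re_plus, re_opp, (Re_mult_conj_inv (F 0) w Hw),
        (Re_mult_conj_inv (F z) w Hw).
      specialize (Hpos z ltac:(lra)).
      assert (Wm := re_le_Cmod w); rewrite Hw in Wm; apply Rabs_le_between in Wm.
      replace (Re (2 * F z)%C) with (2 * Re (F z)) by (symmetry; apply re_scal_l).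
      rewrite !re_mult, re_conj; simpl (Im (Cconj _)); unfold Im in *.
      nra. }
  unfold G in H0; rewrite slope_base in H0.
  replace (2 * F 0 + F 0 * (c * 0) + rho * l + Cconj (F 0) * (c * 0))%C
    with (2 * F 0 + rho * l)%C in H0 by ring.
  rewrite re_plus, !re_scal_l in H0; lra.
Qed.

Lemma center_gradient (F : C -> C) (l : C) :
  (forall z, Cmod z < 1 -> exists d, cder F z d) -> cder F 0 l ->
  (forall z, Cmod z < 1 -> 0 <= Re (F z)) ->
  0 <= 2 * Re (F 0) + Re l.
Proof.
  intros HF Hl Hpos.
  assert (K := fun rho H => center_gradient_rho F l rho H HF Hl Hpos).
  assert (P0 : 0 <= Re (F 0)) by (apply Hpos; rewrite Cmod_0; lra).
  apply Rnot_lt_le; intros N.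
  (* [q] is the radius at which 2 Re(F 0) + rho Re l vanishes. If it were below 1, the midpoint of q
     and 1 would violate the bound. *)
  set (q := 2 * Re (F 0) / - Re l).
  assert (Hq : 0 <= q) by (apply Rdiv_le_0_compat; lra).
  assert (Hq1 : q * - Re l = 2 * Re (F 0)) by (unfold q; field; lra).
  assert (Hq2 : q < 1) by nra.
  specialize (K ((1 + q) / 2) ltac:(lra)); nra.
Qed.

Lemma mobius_in_disc (s : R) (z : C) :
  0 <= s < 1 -> Cmod z < 1 ->
  (1 + s * z)%C <> 0 /\ Cmod ((z + s) / (1 + s * z))%C < 1.
Proof.
  intros Hs Hz.
  assert (Z0 := Cmod_ge_0 z).
  assert (N : (1 + s * z)%C <> 0).
  { apply Cmod_neq_0.
    generalize (Cmod_triangle_sub 1 (- (s * z))%C).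
    rewrite Cmod_1, Cmod_opp, Cmod_mult, Cmod_R, Rabs_pos_eq by lra.
    replace (1 - - (s * z))%C with (1 + s * z)%C by ring; nra. }
  split; auto.
  rewrite Cmod_div by auto.
  assert (P := proj1 (Cmod_gt_0 _) N).
  assert (S1 := Cmod_sqr (1 + s * z)%C); assert (S2 := Cmod_sqr (z + s)%C).
  assert (S3 := Cmod_sqr z).
  apply (Rmult_lt_reg_r (Cmod (1 + s * z)%C)); auto.
  unfold Rdiv; rewrite Rmult_assoc, Rinv_l by lra.
  assert (Q := Cmod_ge_0 (z + s)%C).
  (* |1 + s z|^2 - |z + s|^2 = (1 - s^2)(1 - |z|^2). *)
  assert (Cmod (z + s)%C * Cmod (z + s)%C < Cmod (1 + s * z)%C * Cmod (1 + s * z)%C); [|nra].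
  rewrite S1, S2; destruct z as [x y]; simpl in *.
  assert (x * x + y * y < 1) by nra.
  assert (s * s < 1) by nra.
  nra.
Qed.

Lemma mobius_cder (s : R) (z : C) :
  (1 + s * z)%C <> 0 ->
  cder (fun w => (w + s) / (1 + s * w))%C z
    ((1 - s * s) / ((1 + s * z) * (1 + s * z)))%C.
Proof.
  intros N.
  eapply cder_ext; [reflexivity| |apply cder_div; [exact N
    |exact (cder_plus _ _ _ _ _ (cder_id z) (cder_const s z))
    |exact (cder_plus _ _ _ _ _ (cder_const 1 z) (cder_scal s _ _ _ (cder_id z)))]].
  simpl; field; auto.
Qed.

(** A disc automorphism moves the point at relative radius s to the center, where [center_gradient]
    becomes 2 u + (1 - s^2) u' >= 0 for u the real part along the radius. This says that u
    (1+s)/(1-s) does not decrease, and comparison with s = 0 gives Harnack's inequality without the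
    Poisson kernel. *)
Lemma harnack_lower (f f1 : C -> C) (rho : R) (e : C) (x : R) :
  0 < rho -> Cmod e = 1 -> 0 <= x < rho ->
  (forall z, Cmod z < rho -> cder f z (f1 z)) ->
  (forall z, Cmod z < rho -> 0 <= Re (f z)) ->
  Re (f 0) * (rho - x) / (rho + x) <= Re (f (x * e)%C).
Proof.
  intros HR He Hx Hf Hpos.
  set (k := (rho * e)%C).
  assert (Hk : Cmod k = rho) by (unfold k; rewrite Cmod_mult, Cmod_R, He, Rabs_pos_eq; lra).
  assert (Hin : forall z, Cmod z < 1 -> Cmod (k * z)%C < rho).
  { intros z Hz; rewrite Cmod_mult, Hk; nra. }
  assert (Hs1 : forall s, 0 <= s < 1 -> Cmod (RtoC s) < 1).
  { intros s Hs; rewrite Cmod_R, Rabs_pos_eq; lra. }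
  set (u := fun s : R => Re (f (k * s)%C)).
  set (du := fun s : R => Re (f1 (k * s) * k)%C).
  assert (Du : forall s, 0 <= s < 1 -> is_derive u s (du s)).
  { intros s Hs.
    assert (D := cder_comp f (fun w => k * w)%C s _ _ (Hf _ (Hin _ (Hs1 s Hs)))
      (cder_scal k _ _ _ (cder_id s))).
    destruct (cder_curve _ (fun t => t) (fun _ => 0) s 1 0 _ D
      (is_derive_id _) (is_derive_const _ _)) as [D1 _].
    unfold u, du; eapply is_derive_ext; [|replace (Re (f1 (k * s) * k)%C) with
      (Re (f1 (k * s) * (k * 1) * (1, 0))%C); [exact D1|]].
    - intros; reflexivity.
    - f_equal; change (1, 0) with (RtoC 1); ring. }
  assert (Ineq : forall s, 0 <= s < 1 -> 0 <= 2 * u s + (1 - s * s) * du s).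
  { intros s Hs.
    set (F := fun z => f (k * ((z + s) / (1 + s * z)))%C).
    assert (DF : forall z, Cmod z < 1 -> cder F z
      (f1 (k * ((z + s) / (1 + s * z))) * (k * ((1 - s * s) / ((1 + s * z) * (1 + s * z)))))%C).
    { intros z Hz; destruct (mobius_in_disc s z Hs Hz) as [N M].
      apply (cder_comp f (fun z => k * ((z + s) / (1 + s * z)))%C).
      - apply Hf, Hin, M.
      - apply cder_scal, mobius_cder, N. }
    assert (K := center_gradient F _ (fun z Hz => ex_intro _ _ (DF z Hz))
      (DF 0 ltac:(rewrite Cmod_0; lra))).
    assert (N1 : (1 + s * 0)%C = 1) by ring.
    unfold F in K; rewrite N1 in K.
    replace ((0 + s) / 1)%C with (RtoC s) in K by (field; intros E; apply (f_equal fst) in E; simpl in E; lra).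
    unfold u, du.
    replace ((1 - s * s) * Re (f1 (k * s) * k)%C) with
      (Re (f1 (k * s) * (k * ((1 - s * s) / (1 * 1))))%C).
    - apply K; intros z Hz; destruct (mobius_in_disc s z Hs Hz) as [N M]; apply Hpos, Hin, M.
    - replace (f1 (k * s) * (k * ((1 - s * s) / (1 * 1))))%C with
        (RtoC (1 - s * s) * (f1 (k * s) * k))%C.
      + apply re_scal_l.
      + rewrite RtoC_minus, RtoC_mult; field; intros E; apply (f_equal fst) in E; simpl in E; lra. }
  set (y := x / rho).
  assert (Hy : 0 <= y < 1).
  { unfold y; split; [apply Rdiv_le_0_compat; lra|].
    apply (Rmult_lt_reg_r rho); auto; unfold Rdiv; rewrite Rmult_assoc, Rinv_l; lra. }
  assert (I := increasing_of_derive (fun s => u s * ((1 + s) / (1 - s)))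
    (fun s => (2 * u s + (1 - s * s) * du s) / ((1 - s) * (1 - s))) 0 y (proj1 Hy)).
  assert (U0 : u 0 = Re (f 0)) by (unfold u; do 2 f_equal; ring).
  assert (Uy : u y = Re (f (x * e)%C)).
  { unfold u, k, y; do 2 f_equal; rewrite RtoC_div by lra; field.
    intros E; apply (f_equal fst) in E; simpl in E; lra. }
  assert (I' : u 0 * ((1 + 0) / (1 - 0)) <= u y * ((1 + y) / (1 - y))).
  { apply I.
    - intros s Hs.
      assert (D2 : is_derive (fun s => (1 + s) / (1 - s)) s (2 / ((1 - s) * (1 - s))))
        by (auto_derive; [lra|field; lra]).
      assert (D3 := is_derive_mult u _ s _ _ (Du s ltac:(lra)) D2 Rmult_comm).
      unfold plus, mult in D3; simpl in D3.
      replace ((2 * u s + (1 - s * s) * du s) / ((1 - s) * (1 - s))) with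
        (du s * ((1 + s) / (1 - s)) + u s * (2 / ((1 - s) * (1 - s)))) by (field; lra).
      exact D3.
    - intros s Hs; apply Rdiv_le_0_compat; [apply Ineq; lra|nra]. }
  rewrite U0 in I'; rewrite <- Uy.
  replace (rho - x) with (rho * (1 - y)) by (unfold y; field; lra).
  replace (rho + x) with (rho * (1 + y)) by (unfold y; field; lra).
  replace (Re (f 0) * (rho * (1 - y)) / (rho * (1 + y))) with
    (Re (f 0) * ((1 + 0) / (1 - 0)) * ((1 - y) / (1 + y))) by (field; lra).
  replace (u y) with (u y * ((1 + y) / (1 - y)) * ((1 - y) / (1 + y))) by (field; lra).
  apply Rmult_le_compat_r; auto; apply Rdiv_le_0_compat; lra.
Qed.

(** * Logarithms and the distortion theorem *)

Definition cexp (z : C) : C := (exp (fst z) * cos (snd z), exp (fst z) * sin (snd z)).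

(** Half the logarithm of |z|^2, to avoid a square root. The arctangent is the argument only in the
    right half plane, hence the positivity condition in the lemmas on [clog]. *)
Definition clog (z : C) : C := (ln (fst z * fst z + snd z * snd z) / 2, atan (snd z / fst z)).

Lemma cexp_plus (z w : C) : cexp (z + w)%C = (cexp z * cexp w)%C.
Proof.
  destruct z as [a b], w as [c d]; unfold cexp, Cmult, Cplus; simpl.
  rewrite exp_plus, cos_plus, sin_plus; f_equal; ring.
Qed.

Lemma Cmod_cexp (z : C) : Cmod (cexp z) = exp (Re z).
Proof. apply Cmod_polar, Rlt_le, exp_pos. Qed.

Lemma cexp_clog (z : C) : 0 < fst z -> cexp (clog z) = z.
Proof.
  intros Hx; destruct z as [x y]; unfold cexp, clog; simpl in *.
  rewrite cos_atan, sin_atan.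
  assert (N : 0 < x * x + y * y) by nra.
  assert (E : exp (ln (x * x + y * y) / 2) = x * sqrt (1 + (y / x)²)).
  { replace (exp (ln (x * x + y * y) / 2)) with (sqrt (x * x + y * y)).
    - rewrite <- (sqrt_square x) at 3 by lra.
      rewrite <- sqrt_mult_alt by nra; f_equal; unfold Rsqr; field; lra.
    - rewrite <- Rpower_sqrt by auto; unfold Rpower; f_equal; lra. }
  assert (S : 0 < sqrt (1 + (y / x)²)) by (apply sqrt_lt_R0; generalize (Rle_0_sqr (y / x)); lra).
  rewrite E; f_equal; field; lra.
Qed.

Lemma cder_clog (z : C) : 0 < fst z -> cder clog z (/ z)%C.
Proof.
  intros Hx; destruct z as [x y]; simpl in Hx.
  assert (N : 0 < x * x + y * y) by nra.
  assert (X := dpl_fst x y); assert (Y := dpl_snd x y).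
  assert (D := dpl_plus _ _ _ _ _ _ _ _ (dpl_mult _ _ _ _ _ _ _ _ X X)
     (dpl_mult _ _ _ _ _ _ _ _ Y Y)); simpl in D.
  assert (E1 : is_derive (fun t => ln t / 2) (x * x + y * y) (/ (2 * (x * x + y * y))))
    by (auto_derive; [auto|field; lra]).
  assert (L := dpl_comp1 _ (fun u v => u * u + v * v) _ _ _ _ _ E1 D); simpl in L.
  assert (E2 : is_derive Rinv x (- / x ^ 2)) by (auto_derive; [lra|field; lra]).
  assert (I := dpl_comp1 Rinv (fun u _ => u) _ _ _ _ _ E2 X).
  assert (Q := dpl_mult _ _ _ _ _ _ _ _ Y I); simpl in Q.
  assert (E3 : is_derive atan (y * / x) (/ (1 + (y * / x) ^ 2))).
  { apply is_derive_Reals, derivable_pt_lim_atan. }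
  assert (A := dpl_comp1 atan (fun u v => v * / u) _ _ _ _ _ E3 Q); simpl in A.
  unfold Cinv, clog.
  apply cder_iff; simpl; split.
  - eapply dpl_ext; [| | |apply L]; [reflexivity|field; lra|field; lra].
  - eapply dpl_ext; [| | |apply A]; [reflexivity| |]; field; repeat split; try lra; nra.
Qed.

Lemma clog_1 : clog 1 = 0.
Proof.
  unfold clog, RtoC; simpl.
  replace (1 * 1 + 0 * 0) with 1 by ring; replace (0 / 1) with 0 by field.
  rewrite ln_1, atan_0; f_equal; field.
Qed.

(** The quotients telescope: if f 0 = 1, the exponential of the k-th sum is f(k tau z), as long as
    each quotient has positive real part. *)
Fixpoint log_sum (f : C -> C) (tau : R) (k : nat) (z : C) : C :=
  match k with
  | O => 0
  | S j => log_sum f tau j z +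
           clog (f (RtoC (INR (S j) * tau) * z) / f (RtoC (INR j * tau) * z))
  end%C.

Lemma Re_pos_of_near_1 (z w : C) :
  w <> 0 -> Cmod (z - w)%C < Cmod w / 2 -> 0 < fst (z / w)%C.
Proof.
  intros N H; assert (P := proj1 (Cmod_gt_0 _) N).
  assert (E : (z / w)%C = (1 + (z - w) / w)%C) by (field; auto).
  rewrite E; change (@fst R R) with Re; rewrite re_plus.
  assert (M := re_le_Cmod ((z - w) / w)%C); rewrite Cmod_div in M by auto.
  assert (Cmod (z - w)%C / Cmod w < 1 / 2).
  { apply (Rmult_lt_reg_r (Cmod w)); auto.
    unfold Rdiv at 1; rewrite Rmult_assoc, Rinv_l; lra. }
  apply Rabs_le_between in M; simpl (Re 1); lra.
Qed.

(* Along each radius the logarithm is accumulated in steps so short that the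
   successive quotients stay in the right half plane. *)
Lemma holomorphic_log (f f1 : C -> C) (r : R) :
  0 < r -> (forall z, Cmod z <= r -> cder f z (f1 z) /\ f z <> 0) -> f 0 = 1 ->
  exists L : C -> C, L 0 = 0 /\
    forall z, Cmod z <= r -> cexp (L z) = f z /\ cder L z (f1 z / f z)%C.
Proof.
  intros Hr Hf H0.
  destruct (disc_uniformly_close r f Hr) as [d [Hd K]].
  { intros z Hz; destruct (Hf z Hz) as [D N]; split; auto; eapply cder_ccont, D. }
  (* Each radius is cut into n steps of length at most r/n < d, so that successive values of f are
     close in the sense of [d]. *)
  destruct (archimed_cor1 (d / r)) as [n [Hn Hn0]]; [apply Rdiv_lt_0_compat; auto|].
  set (tau := / INR n).
  assert (Hn1 : 0 < INR n) by (apply lt_0_INR; lia).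
  assert (Ht : 0 < tau) by (apply Rinv_0_lt_compat; auto).
  assert (Htr : tau * r < d).
  { apply (Rmult_lt_compat_r r) in Hn; auto.
    replace (d / r * r) with d in Hn by (field; lra); exact Hn. }
  assert (Hin : forall k z, (k <= n)%nat -> Cmod z <= r -> Cmod (RtoC (INR k * tau) * z)%C <= r).
  { intros k z Hk Hz; apply le_INR in Hk.
    assert (P := pos_INR k).
    rewrite Cmod_mult, Cmod_R, Rabs_pos_eq by nra.
    assert (INR k * tau <= 1).
    { apply Rle_trans with (INR n * tau); [nra|unfold tau; rewrite Rinv_r; lra]. }
    assert (Q := Cmod_ge_0 z); nra. }
  assert (Rec : forall k, (k <= n)%nat -> log_sum f tau k 0 = 0 /\ forall z, Cmod z <= r ->
    cexp (log_sum f tau k z) = f (RtoC (INR k * tau) * z)%C /\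
    cder (log_sum f tau k) z (RtoC (INR k * tau) * f1 (RtoC (INR k * tau) * z) /
       f (RtoC (INR k * tau) * z))%C).
  { induction k as [|k IH]; intros Hk.
    - split; [reflexivity|]; intros z Hz; cbn [log_sum]; simpl INR.
      rewrite Rmult_0_l; replace (0 * z)%C with (RtoC 0) by ring; split.
      + rewrite H0; unfold cexp; simpl; rewrite exp_0, cos_0, sin_0; unfold RtoC; f_equal; ring.
      + eapply cder_ext; [reflexivity| |apply (cder_const 0 z)].
        field; rewrite H0; intros E; apply (f_equal fst) in E; simpl in E; lra.
    - destruct (IH ltac:(lia)) as [IH0 IHz].
      split.
      { cbn [log_sum]; rewrite IH0.
        replace (RtoC (INR (S k) * tau) * 0)%C with (RtoC 0) by ring.
        replace (RtoC (INR k * tau) * 0)%C with (RtoC 0) by ring.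
        rewrite H0; replace (1 / 1)%C with (RtoC 1)
          by (field; intros E; apply (f_equal fst) in E; simpl in E; lra).
        rewrite clog_1; ring. }
      intros z Hz; destruct (IHz z Hz) as [IHe IHd].
      set (b := (RtoC (INR k * tau) * z)%C) in *.
      set (a := (RtoC (INR (S k) * tau) * z)%C).
      destruct (Hf b (Hin k z ltac:(lia) Hz)) as [Db Nb].
      destruct (Hf a (Hin (S k) z Hk Hz)) as [Da Na].
      assert (Pos : 0 < fst (f a / f b)%C).
      { apply Re_pos_of_near_1; auto.
        apply K; [apply (Hin k); auto; lia|apply (Hin (S k)); auto|].
        unfold a, b; rewrite S_INR.
        replace (RtoC ((INR k + 1) * tau) * z - RtoC (INR k * tau) * z)%C with (tau * z)%C
          by (rewrite !RtoC_mult, RtoC_plus; ring).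
        rewrite Cmod_mult, Cmod_R, Rabs_pos_eq by lra; nra. }
      split.
      + cbn [log_sum]; rewrite cexp_plus, IHe; fold a b; rewrite cexp_clog by exact Pos.
        field; auto.
      + assert (D1 := cder_comp f (fun w => RtoC (INR (S k) * tau) * w)%C z _ _ Da
          (cder_scal _ _ _ _ (cder_id z))).
        assert (D2 := cder_comp f (fun w => RtoC (INR k * tau) * w)%C z _ _ Db
          (cder_scal _ _ _ _ (cder_id z))).
        assert (D3 := cder_div _ _ _ _ _ Nb D1 D2).
        cbv beta in D3.
        assert (D4 := cder_comp clog (fun w => f (RtoC (INR (S k) * tau) * w) /
          f (RtoC (INR k * tau) * w))%C z _ _ (cder_clog _ Pos) D3).
        eapply cder_ext; [| |exact (cder_plus _ _ _ _ _ IHd D4)]; [reflexivity|].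
        cbv beta; fold a b; field; auto. }
  exists (log_sum f tau n); destruct (Rec n (le_n n)) as [R0 Rz]; split; auto.
  intros z Hz; specialize (Rz z Hz).
  replace (INR n * tau) with 1 in Rz by (unfold tau; field; lra).
  replace (1 * z)%C with z in Rz by ring.
  destruct Rz as [E D]; split; auto.
  eapply cder_ext; [reflexivity| |exact D].
  field; apply (Hf z Hz).
Qed.

Lemma derive_ray (f : C -> C) (l e : C) (y : R) :
  cder f (y * e)%C l -> is_derive (fun s : R => Re (f (s * e)%C)) y (Re (l * e)%C).
Proof.
  intros H.
  assert (D := cder_comp f (fun w => w * e)%C y _ _ H
    (cder_mult _ _ _ _ _ (cder_id y) (cder_const e y))).
  destruct (cder_curve _ (fun t => t) (fun _ => 0) y 1 0 _ D
      (is_derive_id _) (is_derive_const _ _)) as [D1 _].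
  replace (Re (l * e)%C) with (Re (l * (1 * e + y * 0) * (1, 0))%C).
  - exact D1.
  - f_equal; change (1, 0) with (RtoC 1); ring.
Qed.

(** Harnack bounds the increments of log |f| one at a time, with a slope depending on the far
    endpoint; this passes to the limit as that endpoint tends to y. *)
Lemma derive_lower_bound (u g : R -> R) (y D r : R) :
  y < r -> is_derive u y D -> continuity_pt g y ->
  (forall y', y < y' < r -> (y' - y) * g y' <= u y' - u y) -> g y <= D.
Proof.
  intros Hr Hu Hg H; apply Rnot_lt_le; intros N.
  set (e := (g y - D) / 3).
  assert (He : 0 < e) by (unfold e; lra).
  apply is_derive_Reals in Hu.
  destruct (Hu e He) as [d1 K1].
  destruct (Hg e He) as [d2 [D2 K2]].
  set (h := Rmin (Rmin (d1 / 2) (d2 / 2)) ((r - y) / 2)).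
  assert (P1 := cond_pos d1).
  assert (Hh : 0 < h) by (unfold h; repeat apply Rmin_pos; lra).
  generalize (Rmin_l (Rmin (d1 / 2) (d2 / 2)) ((r - y) / 2))
    (Rmin_r (Rmin (d1 / 2) (d2 / 2)) ((r - y) / 2))
    (Rmin_l (d1 / 2) (d2 / 2)) (Rmin_r (d1 / 2) (d2 / 2)); fold h; intros.
  specialize (K1 h ltac:(lra) ltac:(rewrite Rabs_pos_eq; lra)).
  specialize (K2 (y + h)).
  assert (K2' : R_dist (g (y + h)) (g y) < e).
  { apply K2; split.
    - split; [exact I|lra].
    - unfold Rlimit.dist; simpl; unfold R_dist.
      replace (y + h - y) with h by ring; rewrite Rabs_pos_eq; lra. }
  unfold R_dist in K2'; apply Rabs_def2 in K2'; apply Rabs_def2 in K1.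
  specialize (H (y + h) ltac:(lra)).
  replace (y + h - y) with h in H by ring.
  assert (E : (u (y + h) - u y) = (u (y + h) - u y) / h * h) by (field; lra).
  unfold e in *; nra.
Qed.

Lemma ln_le_minus_1 (x : R) : 0 < x -> ln x <= x - 1.
Proof.
  intros H; generalize (exp_ineq1_le (ln x)); rewrite exp_ln by auto; lra.
Qed.

(** Let F(z) = L(lam z) - L(z) + beta log lam, with L a logarithm of f and lam = y'/y. Its real part
    is nonnegative on |z| < rho/lam and equals beta log lam at 0. Harnack at y e, together with log
    lam <= lam - 1, bounds the increment of log |f| from y to y' below by (y' - y) times -2 beta y'
    / (y (rho + y')), which tends to the claimed slope. *)
Lemma log_derivative_lower_rho (beta : R) (f f1 : C -> C) (rho y : R) (e : C) :
  0 < beta -> 0 < y < rho -> rho < 1 -> Cmod e = 1 ->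
  (forall z, Cmod z < 1 -> cder f z (f1 z) /\ f z <> 0) -> f 0 = 1 ->
  (forall z, Cmod z < 1 -> - beta <= Re (z * f1 z / f z)%C) ->
  - (2 * beta) / (rho + y) <= Re (f1 (y * e) / f (y * e) * e)%C.
Proof.
  intros Hb Hy HR He Hf H0 Hre.
  destruct (holomorphic_log f f1 rho ltac:(lra)) as [L [L0 HL]]; auto.
  { intros z Hz; apply Hf; lra. }
  assert (Hm : forall s : R, 0 <= s -> Cmod (s * e)%C = s).
  { intros s Hs; rewrite Cmod_mult, He, Cmod_R, Rabs_pos_eq; lra. }
  assert (Du : is_derive (fun s : R => Re (L (s * e)%C)) y
     (Re (f1 (y * e) / f (y * e) * e)%C)).
  { apply derive_ray, HL; rewrite Hm; lra. }
  replace (- (2 * beta) / (rho + y)) with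
    ((fun s => - (2 * beta) * s / (y * (rho + s))) y) by (simpl; field; lra).
  apply (derive_lower_bound _ (fun s => - (2 * beta) * s / (y * (rho + s))) y _ rho ltac:(lra) Du).
  { apply derivable_continuous_pt, ex_derive_Reals_0; auto_derive; nra. }
  intros y' Hy'.
  set (lam := y' / y).
  assert (Hlam : 1 < lam).
  { unfold lam; apply (Rmult_lt_reg_r y); [lra|].
    unfold Rdiv; rewrite Rmult_assoc, Rinv_l; lra. }
  assert (Ely : lam * y = y') by (unfold lam; field; lra).
  set (F := fun z => (L (lam * z) - L z + RtoC (beta * ln lam))%C).
  assert (HRl : 0 < rho / lam) by (apply Rdiv_lt_0_compat; lra).
  assert (In1 : forall z (s : R), 1 <= s <= lam -> Cmod z < rho / lam ->
     Cmod (s * z)%C <= rho).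
  { intros z s Hs Hz; rewrite Cmod_mult, Cmod_R, Rabs_pos_eq by lra.
    assert (P := Cmod_ge_0 z).
    apply Rle_trans with (lam * (rho / lam)); [|apply Req_le; field; lra].
    apply Rmult_le_compat; lra. }
  assert (In2 : forall z, Cmod z < rho / lam -> Cmod z <= rho).
  { intros z Hz; specialize (In1 z 1 ltac:(lra) Hz); rewrite Cmult_1_l in In1; auto. }
  assert (DF : forall z, Cmod z < rho / lam -> cder F z
    (f1 (lam * z) / f (lam * z) * lam - f1 z / f z)%C).
  { intros z Hz; unfold F.
    eapply cder_ext; [reflexivity| |apply cder_plus;
      [apply cder_minus; [apply (cder_comp L (fun w => lam * w)%C)|]|apply cder_const]].
    2: { apply HL, In1; auto; lra. }
    2: { apply cder_scal, cder_id. }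
    2: { apply HL, In2, Hz. }
    ring. }
  assert (PF : forall z, Cmod z < rho / lam -> 0 <= Re (F z)).
  { intros z Hz; unfold F; unfold Cminus; rewrite !re_plus, re_opp, re_RtoC.
    (* Along a radius log |f(s z)| + beta log s does not decrease, since s times its derivative is
       Re(w f1(w)/f(w)) + beta at w = s z. *)
    assert (I := increasing_of_derive (fun s : R => Re (L (s * z)%C) + beta * ln s)
      (fun s => Re (f1 (s * z) / f (s * z) * z)%C + beta / s) 1 lam ltac:(lra)).
    assert (I' : Re (L (1 * z)%C) + beta * ln 1 <= Re (L (lam * z)%C) + beta * ln lam).
    { apply I.
      - intros s Hs; apply (is_derive_plus (V := R_NormedModule)).
        + apply derive_ray, HL, In1; auto.
        + auto_derive; [lra|field; lra].
      - intros s Hs.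
        assert (Hsz := In1 z s ltac:(lra) Hz).
        specialize (Hre (s * z)%C ltac:(lra)).
        replace (s * z * f1 (s * z) / f (s * z))%C with
          (RtoC s * (f1 (s * z) / f (s * z) * z))%C in Hre
          by (field; apply Hf; lra).
        rewrite re_scal_l in Hre.
        apply (Rmult_le_reg_l s); [lra|].
        rewrite Rmult_plus_distr_l; replace (s * (beta / s)) with beta by (field; lra); lra. }
    rewrite Cmult_1_l, ln_1 in I'; lra. }
  assert (Hyl : y < rho / lam).
  { apply (Rmult_lt_reg_r lam); [lra|]; unfold Rdiv; rewrite Rmult_assoc, Rinv_l by lra; lra. }
  assert (K := harnack_lower F _ (rho / lam) e y HRl He ltac:(lra) DF PF).
  assert (F0 : Re (F 0) = beta * ln lam).
  { unfold F; replace (lam * 0)%C with (RtoC 0) by ring; rewrite L0.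
    unfold Cminus; rewrite !re_plus, re_opp, !re_RtoC; ring. }
  rewrite F0 in K; unfold F in K; unfold Cminus in K; rewrite !re_plus, re_opp, re_RtoC in K.
  replace (lam * (y * e))%C with (y' * e)%C in K by (rewrite <- Ely, RtoC_mult; ring).
  replace (beta * ln lam * (rho / lam - y) / (rho / lam + y)) with
    (beta * ln lam * ((rho - y') / (rho + y'))) in K by (rewrite <- Ely; field; split; nra).
  assert (Ll := ln_le_minus_1 lam ltac:(lra)).
  assert (E1 : (rho - y') / (rho + y') = 1 - 2 * (y' / (rho + y'))) by (field; lra).
  rewrite E1 in K.
  assert (Q : 0 < y' / (rho + y')) by (apply Rdiv_lt_0_compat; lra).
  replace ((y' - y) * (- (2 * beta) * y' / (y * (rho + y')))) with
    (- (2 * beta) * (y' / (rho + y')) * (lam - 1)) by (unfold lam; field; lra).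
  assert (beta * (y' / (rho + y')) * ln lam <= beta * (y' / (rho + y')) * (lam - 1)).
  { apply Rmult_le_compat_l; [apply Rmult_le_pos; lra|lra]. }
  lra.
Qed.

Lemma log_derivative_lower (beta : R) (f f1 : C -> C) (y : R) (e : C) :
  0 < beta -> 0 < y < 1 -> Cmod e = 1 ->
  (forall z, Cmod z < 1 -> cder f z (f1 z) /\ f z <> 0) -> f 0 = 1 ->
  (forall z, Cmod z < 1 -> - beta <= Re (z * f1 z / f z)%C) ->
  - (2 * beta) / (1 + y) <= Re (f1 (y * e) / f (y * e) * e)%C.
Proof.
  intros Hb Hy He Hf H0 Hre.
  assert (K := fun rho H1 H2 => log_derivative_lower_rho beta f f1 rho y e Hb H1 H2 He Hf H0 Hre).
  set (D := Re (f1 (y * e) / f (y * e) * e)%C) in *; clearbody D.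
  apply Rnot_lt_le; intros N.
  apply (Rmult_lt_compat_r (1 + y)) in N; [|lra].
  replace (- (2 * beta) / (1 + y) * (1 + y)) with (- (2 * beta)) in N by (field; lra).
  set (q := - (2 * beta) - D * (1 + y)) in *.
  assert (HD : D < 0) by nra.
  (* Replacing 1 by the radius 1 - eta costs -eta D, kept to at most half of the gap [q]; the other
     bound keeps y < 1 - eta. *)
  set (eta := Rmin ((1 - y) / 2) (q / (- 2 * D))).
  assert (Hq : 0 < q / (- 2 * D)) by (apply Rdiv_lt_0_compat; unfold q; lra).
  assert (He0 : 0 < eta) by (apply Rmin_pos; lra).
  assert (He1 : eta <= (1 - y) / 2) by apply Rmin_l.
  assert (He2 : eta * (- 2 * D) <= q).
  { apply Rle_trans with (q / (- 2 * D) * (- 2 * D)); [|apply Req_le; field; lra].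
    apply Rmult_le_compat_r; [lra|apply Rmin_r]. }
  specialize (K (1 - eta) ltac:(lra) ltac:(lra)).
  apply (Rmult_le_compat_r (1 - eta + y)) in K; [|lra].
  replace (- (2 * beta) / (1 - eta + y) * (1 - eta + y)) with (- (2 * beta)) in K by (field; lra).
  unfold q in *; nra.
Qed.

(** Along the ray to z, log |f| + 2 beta log(1 + s) starts at 0 and does not decrease. The center is
    separate because it has no direction [e]. *)
Lemma distortion_lower (beta : R) (f f1 : C -> C) (z : C) :
  0 < beta -> Cmod z < 1 ->
  (forall z, Cmod z < 1 -> cder f z (f1 z) /\ f z <> 0) -> f 0 = 1 ->
  (forall z, Cmod z < 1 -> - beta <= Re (z * f1 z / f z)%C) ->
  Rpower (1 + Cmod z) (- (2 * beta)) <= Cmod (f z).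
Proof.
  intros Hb Hz Hf H0 Hre.
  destruct (Req_dec (Cmod z) 0) as [E|N].
  { rewrite E, Rplus_0_r; apply Cmod_eq_0 in E; rewrite E, H0, Cmod_1.
    unfold Rpower; rewrite ln_1, Rmult_0_r, exp_0; lra. }
  assert (P0 := Cmod_ge_0 z).
  set (r := Cmod z) in *; assert (Hr : 0 < r) by lra.
  assert (Nr : RtoC r <> 0) by (intros E; apply (f_equal fst) in E; simpl in E; lra).
  set (e := (z / r)%C).
  assert (He : Cmod e = 1).
  { unfold e; rewrite Cmod_div, Cmod_R, Rabs_pos_eq by (auto; lra); fold r; field; lra. }
  assert (Ez : z = (r * e)%C) by (unfold e; field; auto).
  assert (Hm : forall s : R, 0 <= s -> Cmod (s * e)%C = s).
  { intros s Hs; rewrite Cmod_mult, He, Cmod_R, Rabs_pos_eq; lra. }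
  destruct (holomorphic_log f f1 r Hr) as [L [L0 HL]]; auto.
  { intros w Hw; apply Hf; lra. }
  set (u := fun s : R => Re (L (s * e)%C) + (2 * beta) * ln (1 + s)).
  assert (Du : forall s, 0 <= s <= r -> is_derive u s
    (Re (f1 (s * e) / f (s * e) * e)%C + (2 * beta) / (1 + s))).
  { intros s Hs; apply (is_derive_plus (V := R_NormedModule)).
    - apply derive_ray, HL; rewrite Hm; lra.
    - auto_derive; [lra|field; lra]. }
  assert (U0 : u 0 = 0).
  { unfold u; replace (0 * e)%C with (RtoC 0) by ring; rewrite L0, Rplus_0_r, ln_1; simpl; ring. }
  assert (UR : 0 <= u r).
  { rewrite <- U0.
    apply (increasing_of_derive u _ 0 r (Rlt_le _ _ Hr) Du).
    intros t Ht.
    assert (K := log_derivative_lower beta f f1 t e Hb ltac:(lra) He Hf H0 Hre).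
    replace (- (2 * beta) / (1 + t)) with (- (2 * beta / (1 + t))) in K by (field; lra); lra. }
  destruct (HL z) as [Ex _]; [fold r; lra|].
  rewrite <- Ex, Cmod_cexp; unfold u in UR; rewrite <- Ez in UR.
  unfold Rpower.
  destruct (Rle_lt_or_eq_dec (- (2 * beta) * ln (1 + r)) (Re (L z))) as [Q|Q]; [lra| |].
  - apply Rlt_le, exp_increasing, Q.
  - rewrite Q; lra.
Qed.

(** * First-order conditions at a maximum over a disc *)

Lemma max_direction (F : C -> C) (r s0 : R) (a c d : C) :
  cder F a c -> (forall w, Cmod w <= r -> Re (F w) <= Re (F a)) ->
  0 < s0 -> (forall s : R, 0 < s < s0 -> Cmod (a + s * d)%C <= r) ->
  Re (c * d)%C <= 0.
Proof.
  intros HF Hmax Hs0 Hin; apply Rnot_lt_le; intros Hp.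
  assert (Pd := Cmod_ge_0 d).
  set (e := Re (c * d)%C / (2 * (Cmod d + 1))).
  assert (He : 0 < e) by (apply Rdiv_lt_0_compat; lra).
  assert (Ee : e * Cmod d < Re (c * d)%C).
  { apply Rlt_le_trans with (e * (2 * (Cmod d + 1))); [nra|].
    apply Req_le; unfold e; field; lra. }
  destruct (HF e He) as [dl [Hdl K]].
  set (s := Rmin (s0 / 2) (dl / (2 * (Cmod d + 1)))).
  assert (Q : 0 < dl / (2 * (Cmod d + 1))) by (apply Rdiv_lt_0_compat; lra).
  assert (Hs : 0 < s) by (apply Rmin_pos; lra).
  assert (Hs1 : s <= s0 / 2) by apply Rmin_l.
  assert (Hs2 : s * (2 * (Cmod d + 1)) <= dl).
  { apply Rle_trans with (dl / (2 * (Cmod d + 1)) * (2 * (Cmod d + 1))).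
    - apply Rmult_le_compat_r; [lra|apply Rmin_r].
    - apply Req_le; field; lra. }
  specialize (K (a + s * d)%C).
  replace (a + s * d - a)%C with (s * d)%C in K by ring.
  rewrite Cmod_mult, Cmod_R, Rabs_pos_eq in K by lra.
  specialize (K ltac:(nra)).
  specialize (Hmax _ (Hin s ltac:(lra))).
  match type of K with Cmod ?w <= _ => assert (M := re_le_Cmod w) end.
  apply Rabs_le_between in M; destruct M as [M _].
  replace (c * (s * d))%C with (s * (c * d))%C in M, K by ring.
  unfold Cminus in M, K; rewrite !re_plus, !re_opp, re_scal_l in M.
  nra.
Qed.

(** In the direction conj c the first-order condition reads |c|^2 <= 0. *)
Lemma max_interior_cder (F : C -> C) (r : R) (a c : C) :
  Cmod a < r -> cder F a c -> (forall w, Cmod w <= r -> Re (F w) <= Re (F a)) -> c = 0.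
Proof.
  intros Ha HF Hmax.
  assert (Pd := Cmod_ge_0 (Cconj c)).
  assert (H : Re (c * Cconj c)%C <= 0).
  { apply (max_direction F r ((r - Cmod a) / (Cmod (Cconj c) + 1)) a c); auto.
    - apply Rdiv_lt_0_compat; lra.
    - intros s Hs; eapply Rle_trans; [apply Cmod_triangle|].
      rewrite Cmod_mult, Cmod_R, Rabs_pos_eq by lra.
      assert (s * (Cmod (Cconj c) + 1) < r - Cmod a); [|nra].
      replace (r - Cmod a) with ((r - Cmod a) / (Cmod (Cconj c) + 1) * (Cmod (Cconj c) + 1))
        by (field; lra).
      apply Rmult_lt_compat_r; lra. }
  rewrite <- Cmod2_conj, re_RtoC in H.
  apply Cmod_eq_0; assert (P := Cmod_ge_0 c); nra.
Qed.

(** Every direction -a(1 + ik) with k real points into the disc, since |1 - s(1 + ik)|^2 = 1 - 2s +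
    s^2(1 + k^2) <= 1 for small s > 0. Hence Re(ca) - k Im(ca) >= 0 for all k. *)
Lemma max_boundary_cder (F : C -> C) (r : R) (a c : C) :
  Cmod a = r -> cder F a c -> (forall w, Cmod w <= r -> Re (F w) <= Re (F a)) ->
  Im (c * a)%C = 0 /\ 0 <= Re (c * a)%C.
Proof.
  intros Ha HF Hmax.
  assert (H : forall k : R, 0 <= Re (c * a)%C - k * Im (c * a)%C).
  { intros k.
    assert (Hk : 0 < 1 + k * k) by nra.
    assert (H : Re (c * (- (a * (1, k))))%C <= 0).
    { apply (max_direction F r (/ (1 + k * k)) a c); auto.
      - apply Rinv_0_lt_compat; lra.
      - intros s Hs.
        replace (a + s * - (a * (1, k)))%C with (Cmult a ((1 - s)%R, (- (s * k))%R))
          by (destruct a; unfold Cmult, Cplus, Copp, RtoC; simpl; f_equal; ring).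
        rewrite Cmod_mult, Ha.
        enough (Cmod (1 - s, - (s * k)) <= 1) by (generalize (Cmod_ge_0 a); nra).
        assert (s * (1 + k * k) < 1).
        { apply Rlt_le_trans with (/ (1 + k * k) * (1 + k * k)).
          - apply Rmult_lt_compat_r; lra.
          - rewrite Rinv_l; lra. }
        assert (S := Cmod_sqr (1 - s, - (s * k))); simpl in S.
        assert (P := Cmod_ge_0 (1 - s, - (s * k))).
        assert ((1 - s) * (1 - s) + - (s * k) * - (s * k) <= 1) by nra.
        nra. }
    replace (c * - (a * (1, k)))%C with (- ((c * a) * (1, k)))%C in H by ring.
    rewrite re_opp, re_mult in H; simpl (Re (1, k)) in H; simpl (Im (1, k)) in H; lra. }
  assert (H0 := H 0).
  split; [|lra].
  destruct (Req_dec (Im (c * a)%C) 0) as [E|N]; auto.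
  (* This k would make Re(ca) - k Im(ca) equal to -1. *)
  specialize (H ((Re (c * a)%C + 1) / Im (c * a)%C)).
  replace ((Re (c * a)%C + 1) / Im (c * a)%C * Im (c * a)%C) with (Re (c * a)%C + 1) in H
    by (field; auto); lra.
Qed.

Lemma unit_angle (w : C) :
  Cmod w = 1 -> w <> 1 -> exists s, 0 < s < 2 * PI /\ w = (cos s, sin s).
Proof.
  intros H N.
  assert (S := Cmod_sqr w); rewrite H in S.
  destruct w as [x y]; simpl in S.
  assert (Hx : -1 <= x <= 1) by nra.
  assert (Hx1 : x < 1).
  { destruct (Req_dec x 1) as [->|]; [|lra].
    exfalso; apply N; unfold RtoC; f_equal; nra. }
  assert (B := acos_bound x); assert (HPI := PI_RGT_0).
  assert (Cx := cos_acos x Hx); assert (Sx := sin_acos x Hx).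
  assert (A0 : acos x <> 0) by (intros E; rewrite E, cos_0 in Cx; lra).
  assert (Sq : sqrt (1 - x²) = Rabs y).
  { rewrite <- sqrt_Rsqr_abs; f_equal; unfold Rsqr; lra. }
  destruct (Rle_lt_dec 0 y).
  - exists (acos x); split; [lra|].
    rewrite Cx, Sx, Sq, Rabs_pos_eq; auto.
  - exists (- acos x + 2 * PI); split; [lra|].
    rewrite cos_plus, sin_plus, cos_2PI, sin_2PI, cos_neg, sin_neg, Cx, Sx, Sq, Rabs_left by auto.
    f_equal; ring.
Qed.

(** * Convexity of the image and increments *)

Definition cis (t : R) : C := (cos t, sin t).

Lemma Cmod_cis (t : R) : Cmod (cis t) = 1.
Proof.
  rewrite <- (Cmod_polar 1 t) by lra; unfold cis; now rewrite !Rmult_1_l.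
Qed.

Lemma derive_rotation (f : C -> C) (a l : C) (t : R) :
  cder f (a * cis t)%C l ->
  is_derive (fun s => Re (f (a * cis s)%C)) t (Re (l * (Ci * (a * cis t)))%C) /\
  is_derive (fun s => Im (f (a * cis s)%C)) t (Im (l * (Ci * (a * cis t)))%C).
Proof.
  intros H; destruct a as [x y].
  replace (Ci * ((x, y) * cis t))%C with
    (- (x * sin t) - y * cos t, x * cos t - y * sin t)
    by (unfold cis, Ci, Cmult; simpl; f_equal; ring).
  apply (cder_curve f (fun s => x * cos s - y * sin s) (fun s => x * sin s + y * cos s)).
  - exact H.
  - auto_derive; [auto|ring].
  - auto_derive; [auto|ring].
Qed.

Lemma Re_Ci_mult (w : C) : Re (Ci * w)%C = - Im w.
Proof. rewrite Cmult_comm; apply re_mult_Ci. Qed.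

Lemma Im_Ci_mult (w : C) : Im (Ci * w)%C = Re w.
Proof. destruct w; simpl; ring. Qed.

(** The last clause is the classical analytic criterion for a convex image; for [in_F] it follows
    from alpha >= 0. *)
Definition convex_data (h h1 h2 : C -> C) : Prop :=
  (forall z, Cmod z < 1 -> cder h z (h1 z)) /\
  (forall z, Cmod z < 1 -> cder h1 z (h2 z) /\ h1 z <> 0) /\
  h1 0 = 1 /\
  (forall z, Cmod z < 1 -> 0 < Re (1 + z * h2 z / h1 z)%C).

(* The tangent to the image of a circle turns strictly and by exactly 2 pi in
   one revolution, because [log h1] is single valued; so the distance to the
   tangent at [h a] first increases, then decreases back to zero. *)
Lemma circle_separation (h h1 h2 : C -> C) (a b : C) :
  convex_data h h1 h2 -> 0 < Cmod a < 1 -> Cmod b = Cmod a -> b <> a ->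
  0 < Re ((h a - h b) * Cconj (a * h1 a))%C.
Proof.
  intros (Hh & Hh1 & H0 & Hp) Ha Hb N.
  assert (Na := Cmod_neq_0 a (proj1 Ha)).
  destruct (unit_angle (b / a)%C) as [t [Ht E]].
  { rewrite Cmod_div, Hb by auto; field; lra. }
  { intros E; apply N; replace b with (b / a * a)%C by (field; auto); rewrite E; ring. }
  assert (Eb : b = (a * cis t)%C) by (unfold cis; rewrite <- E; field; auto).
  destruct (holomorphic_log h1 h2 (Cmod a) (proj1 Ha)) as [L [L0 HL]]; auto.
  { intros z Hz; apply Hh1; lra. }
  assert (Hin : forall s, Cmod (a * cis s)%C = Cmod a).
  { intros s; rewrite Cmod_mult, Cmod_cis; ring. }
  assert (Per : forall s, (a * cis (s + 2 * PI))%C = (a * cis s)%C).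
  { intros s; unfold cis; rewrite cos_plus, sin_plus, cos_2PI, sin_2PI; f_equal; f_equal; ring. }
  assert (A0 : (a * cis 0)%C = a).
  { unfold cis; rewrite cos_0, sin_0; change (1, 0) with (RtoC 1); ring. }
  assert (A2 : (a * cis (2 * PI))%C = a).
  { rewrite <- (Rplus_0_l (2 * PI)), Per; exact A0. }
  (* [T] is the angle from the tangent at h(a) to the tangent at h(a e^(is)), whose direction is i a
     e^(is) h1(a e^(is)). *)
  set (T := fun s => s + Im (L (a * cis s)%C) - Im (L a)).
  set (dT := fun s => Re (1 + a * cis s * h2 (a * cis s) / h1 (a * cis s))%C).
  assert (DT : forall s, is_derive T s (dT s)).
  { intros s.
    destruct (HL (a * cis s)%C) as [_ D]; [rewrite Hin; lra|].
    destruct (derive_rotation L a _ s D) as [_ D2].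
    assert (Ed : dT s = 1 + Im (h2 (a * cis s) / h1 (a * cis s) * (Ci * (a * cis s)))%C).
    { unfold dT; rewrite re_plus, re_RtoC.
      replace (h2 (a * cis s) / h1 (a * cis s) * (Ci * (a * cis s)))%C with
        (Ci * (a * cis s * h2 (a * cis s) / h1 (a * cis s)))%C.
      - now rewrite Im_Ci_mult.
      - field; apply Hh1; rewrite Hin; lra. }
    rewrite Ed; unfold T.
    eapply is_derive_ext; [|apply (is_derive_plus (V := R_NormedModule) (fun s => s - Im (L a)));
      [|exact D2]].
    - intros; unfold plus; simpl; ring.
    - auto_derive; [auto|ring]. }
  assert (MT : forall s s', s < s' -> T s < T s').
  { intros s s' Hs; apply (strictly_increasing_of_derive T dT); auto.
    intros; apply Hp; rewrite Hin; lra. }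
  assert (T0 : T 0 = 0) by (unfold T; rewrite A0; ring).
  assert (T2 : T (2 * PI) = 2 * PI) by (unfold T; rewrite A2; ring).
  (* The vector a h1(a) is the outer normal at h(a), so [p] is the distance to the tangent there
     times |a h1(a)|. Its derivative is the product of the moduli of the two tangent vectors, which
     is [k], times the sine of their angle [T]. *)
  set (p := fun s => Re ((h a - h (a * cis s)) * Cconj (a * h1 a))%C).
  set (k := fun s => Cmod a * Cmod a * exp (Re (L (a * cis s)%C)) * exp (Re (L a))).
  assert (Kpos : forall s, 0 < k s).
  { intros s; unfold k; repeat apply Rmult_lt_0_compat; try apply exp_pos; lra. }
  assert (Dp : forall s, is_derive p s (k s * sin (T s))).
  { intros s.
    assert (D : cder (fun w => (h a - h w) * Cconj (a * h1 a))%C (a * cis s)%C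
       (- h1 (a * cis s)%C * Cconj (a * h1 a))%C).
    { eapply cder_ext; [reflexivity| |apply cder_mult;
        [apply cder_minus; [apply cder_const|apply Hh; rewrite Hin; lra]|apply cder_const]].
      simpl; ring. }
    destruct (derive_rotation _ a _ s D) as [D1 _].
    match type of D1 with is_derive _ _ ?v => replace (k s * sin (T s)) with v end; [exact D1|].
    replace (- h1 (a * cis s)%C * Cconj (a * h1 a) * (Ci * (a * cis s)))%C with
      (Ci * (- ((a * Cconj a) * (h1 (a * cis s)%C * (cis s * Cconj (h1 a))))))%C.
    2:{ rewrite Cmult_conj; ring. }
    rewrite Re_Ci_mult, <- Cmod2_conj.
    rewrite <- (proj1 (HL a ltac:(lra))), <- (proj1 (HL (a * cis s)%C ltac:(rewrite Hin; lra))).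
    unfold k, T.
    replace (s + Im (L (a * cis s)%C) - Im (L a)) with ((s + Im (L (a * cis s)%C)) + - Im (L a)) by ring.
    rewrite sin_plus, sin_plus, cos_plus, cos_neg, sin_neg.
    unfold cexp, cis, Re, Im; simpl; ring. }
  replace (Re ((h a - h b) * Cconj (a * h1 a))%C) with (p t) by (unfold p; now rewrite Eb).
  assert (P0 : p 0 = 0).
  { unfold p; rewrite A0; replace (h a - h a)%C with (RtoC 0) by ring; rewrite Cmult_0_l; reflexivity. }
  assert (P2 : p (2 * PI) = 0).
  { unfold p; rewrite A2; replace (h a - h a)%C with (RtoC 0) by ring; rewrite Cmult_0_l; reflexivity. }
  (* If T(t) <= PI then [p] has increased from p(0) = 0 all the way to t; otherwise it decreases
     from t on down to p(2 PI) = 0. *)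
  destruct (Rle_lt_dec (T t) PI) as [Hl|Hl].
  - rewrite <- P0; apply (strictly_increasing_of_derive p (fun s => k s * sin (T s))); [lra|auto|].
    intros s Hs; apply Rmult_lt_0_compat; auto.
    assert (M1 := MT 0 s ltac:(lra)); assert (M2 := MT s t ltac:(lra)).
    apply sin_gt_0; lra.
  - enough (- p t < - p (2 * PI)) by lra.
    apply (strictly_increasing_of_derive (fun s => - p s) (fun s => - (k s * sin (T s)))); [lra| |].
    + intros; apply (is_derive_opp (V := R_NormedModule)), Dp.
    + intros s Hs.
      assert (M1 := MT t s ltac:(lra)); assert (M2 := MT s (2 * PI) ltac:(lra)).
      assert (sin (T s) < 0) by (apply sin_lt_0; lra).
      specialize (Kpos s); nra.
Qed.

(** The linear functional w -> Re(h(w) conj(a h1(a))) has a maximum over |w| <= |a|. It is not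
    interior, as h1 has no zero, and by [circle_separation] it is at no boundary point other than a.
    So a is the maximizer, and an interior b, not being one, stays strictly below. *)
Lemma disc_separation (h h1 h2 : C -> C) (a b : C) :
  convex_data h h1 h2 -> Cmod a < 1 -> Cmod b <= Cmod a -> b <> a ->
  0 < Re ((h a - h b) * Cconj (a * h1 a))%C.
Proof.
  intros HD Ha Hb N.
  assert (HD' := HD); destruct HD' as (Hh & Hh1 & _ & _).
  assert (Pa : 0 < Cmod a).
  { destruct (Req_dec (Cmod a) 0) as [E|]; [|generalize (Cmod_ge_0 a); lra].
    exfalso; apply N.
    assert (Cmod b = 0) by (generalize (Cmod_ge_0 b); lra).
    rewrite (Cmod_eq_0 a), (Cmod_eq_0 b); auto. }
  assert (Na := Cmod_neq_0 a Pa).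
  destruct (Rle_lt_or_eq_dec _ _ Hb) as [Hlt|Heq]; [|now apply (circle_separation h h1 h2)].
  set (c := Cconj (a * h1 a)).
  assert (Nc : c <> 0).
  { apply Cmod_neq_0; unfold c; rewrite Cmod_conj; apply Cmod_gt_0.
    apply Cmult_neq_0; auto; apply Hh1, Ha. }
  set (F := fun w => (h w * c)%C).
  assert (DF : forall z, Cmod z < 1 -> cder F z (h1 z * c)%C).
  { intros z Hz; eapply cder_ext; [reflexivity| |apply cder_mult; [apply Hh, Hz|apply cder_const]].
    simpl; ring. }
  destruct (disc_max_exists (Cmod a) (fun w => Re (F w)) Pa) as [m [Hm Hmax]].
  { intros z Hz eps Heps.
    destruct (cder_ccont _ _ _ (DF z ltac:(lra)) eps Heps) as [d [Hd K]].
    exists d; split; auto; intros w _ Hw.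
    replace (Re (F w) - Re (F z)) with (Re (F w - F z)%C)
      by (unfold Cminus; rewrite re_plus, re_opp; ring).
    eapply Rle_lt_trans; [apply re_le_Cmod|auto]. }
  assert (Int : forall z, Cmod z < Cmod a -> exists w, Cmod w <= Cmod a /\ Re (F z) < Re (F w)).
  { intros z Hz; apply NNPP; intros Nw.
    assert (E : (h1 z * c)%C = 0).
    { apply (max_interior_cder F (Cmod a) z); auto.
      - apply DF; lra.
      - intros w Hw; apply Rnot_lt_le; intros Q; apply Nw; now exists w. }
    revert E; apply Cmult_neq_0; auto; apply Hh1; lra. }
  assert (Em : m = a).
  { destruct (Ceq_dec m a) as [|Nm]; auto; exfalso.
    destruct (Rle_lt_or_eq_dec _ _ Hm) as [Q|Q].
    - destruct (Int m Q) as [w [Hw L]]; specialize (Hmax w Hw); lra.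
    - assert (S := circle_separation h h1 h2 a m HD (conj Pa Ha) Q Nm).
      specialize (Hmax a ltac:(lra)).
      fold c in S; replace ((h a - h m) * c)%C with (F a - F m)%C in S by (unfold F; ring).
      unfold Cminus in S; rewrite re_plus, re_opp in S; lra. }
  subst m.
  destruct (Int b Hlt) as [w [Hw L]]; specialize (Hmax w Hw).
  replace ((h a - h b) * c)%C with (F a - F b)%C by (unfold F; ring).
  unfold Cminus; rewrite re_plus, re_opp; lra.
Qed.

(** Strict separation at the point of larger modulus excludes equal values. *)
Lemma convex_injective (h h1 h2 : C -> C) (a b : C) :
  convex_data h h1 h2 -> Cmod a < 1 -> Cmod b < 1 -> a <> b -> h a <> h b.
Proof.
  intros HD Ha Hb N E.
  assert (Z : forall w, Re ((h a - h a) * w)%C = 0).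
  { intros w; replace ((h a - h a) * w)%C with (RtoC 0) by ring; reflexivity. }
  destruct (Rle_lt_dec (Cmod b) (Cmod a)) as [L|L].
  - assert (S := disc_separation h h1 h2 a b HD Ha L (not_eq_sym N)).
    rewrite <- E, Z in S; lra.
  - assert (S := disc_separation h h1 h2 b a HD Hb (Rlt_le _ _ L) N).
    rewrite <- E, Z in S; lra.
Qed.

Lemma Re_div_pos (z w : C) : w <> 0 -> 0 < Re (z * Cconj w)%C -> 0 < Re (z / w)%C.
Proof.
  intros N H; assert (S := sum_sqr_neq_0 w N).
  destruct z as [x y], w as [u v]; unfold Cdiv, Cinv, Re in *; simpl in *.
  replace (x * (u / (u * (u * 1) + v * (v * 1))) - y * (- v / (u * (u * 1) + v * (v * 1))))
    with ((x * u - y * - v) / (u * u + v * v)) by (field; lra).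
  apply Rdiv_lt_0_compat; [auto|nra].
Qed.

(* [q z = (G z - G b) / (h z - h b)] is an average of [G'/h'] over the segment
   from [h b] to [h z]; instead of integrating along its preimage, one maximises
   [Re (e q)] and reads the bound off the first-order conditions. *)
Lemma increment_ratio_bound (h h1 h2 G G1 : C -> C) (r M : R) (a b : C) :
  convex_data h h1 h2 -> 0 < r < 1 ->
  (forall z, Cmod z <= r -> cder G z (G1 z)) ->
  (forall z, Cmod z <= r -> Cmod (G1 z) <= M * Cmod (h1 z)) ->
  Cmod a <= r -> Cmod b <= r ->
  Cmod (G a - G b)%C <= M * Cmod (h a - h b)%C.
Proof.
  intros HD Hr HG HM Ha Hb.
  assert (HD' := HD); destruct HD' as (Hh & Hh1 & _ & _).
  destruct (Ceq_dec a b) as [->|Nab].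
  { replace (G b - G b)%C with (RtoC 0) by ring; replace (h b - h b)%C with (RtoC 0) by ring.
    rewrite Cmod_0; lra. }
  set (sG := slope G b (G1 b)); set (sh := slope h b (h1 b)).
  assert (Nsh : forall z, Cmod z <= r -> sh z <> 0).
  { intros z Hz; unfold sh; destruct (Ceq_dec z b) as [->|N].
    - rewrite slope_base; apply Hh1; lra.
    - rewrite slope_eq by auto.
      assert (N1 := Cminus_neq_0 _ _ N).
      apply Cmod_neq_0; rewrite Cmod_div by auto; apply Rdiv_lt_0_compat; apply Cmod_gt_0; auto.
      apply Cminus_neq_0, (convex_injective h h1 h2); auto; lra. }
  set (q := fun z => (sG z / sh z)%C).
  assert (Eq : forall z, Cmod z <= r -> z <> b -> q z = ((G z - G b) / (h z - h b))%C).
  { intros z Hz N; unfold q, sG, sh; rewrite !slope_eq by auto.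
    field; split; apply Cminus_neq_0; auto; apply (convex_injective h h1 h2); auto; lra. }
  assert (Dq : forall z, Cmod z <= r -> z <> b ->
    cder q z ((G1 z - q z * h1 z) / (h z - h b))%C).
  { intros z Hz N.
    assert (N1 := Cminus_neq_0 _ _ N).
    assert (N2 : (h z - h b)%C <> 0).
    { apply Cminus_neq_0, (convex_injective h h1 h2); auto; lra. }
    eapply cder_ext; [reflexivity| |apply (cder_div sG sh);
      [apply Nsh, Hz|apply slope_cder; [exact N|apply HG, Hz]
      |apply slope_cder; [exact N|apply Hh; lra]]].
    rewrite (Eq z Hz N); unfold sG, sh; rewrite !slope_eq by auto; field; auto. }
  assert (Cq : forall z, Cmod z <= r -> ccont q z).
  { intros z Hz; destruct (Ceq_dec z b) as [->|N].
    - apply ccont_div; [apply Nsh, Hz|apply slope_ccont, HG, Hz|apply slope_ccont, Hh; lra].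
    - eapply cder_ccont, Dq; auto. }
  enough (Hq : Cmod (q a) <= M).
  { assert (N2 : (h a - h b)%C <> 0).
    { apply Cminus_neq_0, (convex_injective h h1 h2); auto; lra. }
    rewrite (Eq a Ha Nab), Cmod_div in Hq by auto.
    assert (P := proj1 (Cmod_gt_0 _) N2).
    apply (Rmult_le_compat_r (Cmod (h a - h b)%C)) in Hq; [|lra].
    unfold Rdiv in Hq; rewrite Rmult_assoc, Rinv_l in Hq by lra; lra. }
  assert (PM : 0 <= M).
  { specialize (HM b Hb); assert (P := proj1 (Cmod_gt_0 _) (proj2 (Hh1 b ltac:(lra)))).
    assert (Q := Cmod_ge_0 (G1 b)); nra. }
  destruct (Ceq_dec (q a) 0) as [->|Nq]; [rewrite Cmod_0; auto|].
  assert (Pq := proj1 (Cmod_gt_0 _) Nq).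
  assert (Nm : RtoC (Cmod (q a)) <> 0)
    by (intros E; apply (f_equal fst) in E; simpl in E; lra).
  (* The rotation [e] makes e q(a) equal to |q(a)|, so bounding Re(e q) at its maximum bounds
     |q(a)|. *)
  set (e := (Cconj (q a) / Cmod (q a))%C).
  assert (He : Cmod e = 1).
  { unfold e; rewrite Cmod_div, Cmod_conj, Cmod_R, Rabs_pos_eq by (auto; lra); field; lra. }
  assert (Ee : Re (e * q a)%C = Cmod (q a)).
  { unfold e; replace (Cconj (q a) / Cmod (q a) * q a)%C with
      ((q a * Cconj (q a)) / Cmod (q a))%C by (field; auto).
    rewrite <- Cmod2_conj, <- RtoC_div, re_RtoC by lra; field; lra. }
  destruct (disc_max_exists r (fun w => Re (e * q w)%C) (proj1 Hr)) as [m [Hm Hmax]].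
  { intros z Hz eps Heps.
    destruct (Cq z Hz eps Heps) as [d [Hd K]].
    exists d; split; auto; intros w _ Hw.
    replace (Re (e * q w)%C - Re (e * q z)%C) with (Re (e * (q w - q z))%C)
      by (rewrite !re_mult; unfold Cminus, Re, Im; simpl; ring).
    eapply Rle_lt_trans; [apply re_le_Cmod|rewrite Cmod_mult, He, Rmult_1_l; auto]. }
  assert (Nh := proj2 (Hh1 m ltac:(lra))).
  assert (Fin : Re (e * (G1 m / h1 m))%C <= M).
  { eapply Rle_trans; [apply Re_le_Cmod|].
    rewrite Cmod_mult, He, Rmult_1_l, Cmod_div by auto.
    assert (P := proj1 (Cmod_gt_0 _) Nh).
    apply (Rmult_le_reg_r (Cmod (h1 m))); auto.
    unfold Rdiv; rewrite Rmult_assoc, Rinv_l by lra; specialize (HM m Hm); lra. }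
  enough (Hle : Re (e * q m)%C <= Re (e * (G1 m / h1 m))%C).
  { specialize (Hmax a Ha); lra. }
  destruct (Ceq_dec m b) as [->|Nmb].
  { unfold q, sG, sh; rewrite !slope_base; lra. }
  assert (N2 : (h m - h b)%C <> 0).
  { apply Cminus_neq_0, (convex_injective h h1 h2); auto; lra. }
  assert (DF : cder (fun w => e * q w)%C m (e * ((G1 m - q m * h1 m) / (h m - h b)))%C)
    by (apply cder_scal, Dq; auto).
  destruct (Rle_lt_or_eq_dec _ _ Hm) as [Q|Q].
  (* At an interior maximum q' = 0, that is q(m) = G1(m)/h1(m). *)
  - assert (E := max_interior_cder _ r m _ Q DF Hmax).
    replace (e * (G1 m / h1 m))%C with (e * q m +
      (e * ((G1 m - q m * h1 m) / (h m - h b))) * ((h m - h b) / h1 m))%C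
      by (field; auto).
    rewrite E, Cmult_0_l, Cplus_0_r; lra.
  (* At a boundary maximum k = m (e q)'(m) is real and nonnegative, and e G1/h1 exceeds e q at m by
     k (h(m) - h(b))/(m h1(m)). Separation gives this last quotient positive real part. *)
  - destruct (max_boundary_cder _ r m _ Q DF Hmax) as [Im0 Re0].
    assert (Nm0 := Cmod_neq_0 m ltac:(lra)).
    set (k := (e * ((G1 m - q m * h1 m) / (h m - h b)) * m)%C) in *.
    assert (Ek : k = RtoC (Re k)).
    { rewrite (surjective_pairing k) at 1; unfold RtoC; f_equal; exact Im0. }
    replace (e * (G1 m / h1 m))%C with (e * q m + k * ((h m - h b) / (m * h1 m)))%C
      by (unfold k; field; auto).
    rewrite re_plus, Ek, re_scal_l.
    assert (S : 0 < Re ((h m - h b) / (m * h1 m))%C).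
    { apply Re_div_pos; [apply Cmult_neq_0; auto|].
      apply (disc_separation h h1 h2); auto; lra. }
    nra.
Qed.

(** * The function L and the main bound *)

Lemma exp_le (x y : R) : x <= y -> exp x <= exp y.
Proof.
  intros H; destruct (Rle_lt_or_eq_dec _ _ H) as [L|E]; [|rewrite E; lra].
  apply Rlt_le, exp_increasing, L.
Qed.

Lemma Rpower_base_1 (p : R) : Rpower 1 p = 1.
Proof. unfold Rpower; now rewrite ln_1, Rmult_0_r, exp_0. Qed.

Lemma is_derive_Rpower_1p (p x : R) :
  0 <= x -> is_derive (fun t => Rpower (1 + t) p) x (p * Rpower (1 + x) (p - 1)).
Proof.
  intros Hx; unfold Rpower; auto_derive; [lra|].
  replace ((p - 1) * ln (1 + x)) with (p * ln (1 + x) + - ln (1 + x)) by ring.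
  rewrite exp_plus, exp_Ropp, exp_ln by lra; field; lra.
Qed.

Lemma Rpower_1p_le_1 (p x : R) : 0 <= x -> p <= 0 -> Rpower (1 + x) p <= 1.
Proof.
  intros Hx Hp; apply Rle_trans with (exp 0); [|rewrite exp_0; lra].
  apply exp_le.
  assert (ln 1 <= ln (1 + x)) by (apply ln_le; lra).
  rewrite ln_1 in *; nra.
Qed.

Lemma Rpower_bernoulli (p x : R) : 0 <= p <= 1 -> 0 <= x -> Rpower (1 + x) p <= 1 + p * x.
Proof.
  intros Hp Hx.
  assert (I := increasing_of_derive (fun t => 1 + p * t - Rpower (1 + t) p)
    (fun t => p - p * Rpower (1 + t) (p - 1)) 0 x Hx).
  assert (I' : 1 + p * 0 - Rpower (1 + 0) p <= 1 + p * x - Rpower (1 + x) p).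
  { apply I.
    - intros t Ht.
      apply (is_derive_minus (V := R_NormedModule) (fun t => 1 + p * t)).
      + auto_derive; [auto|ring].
      + apply is_derive_Rpower_1p; lra.
    - intros t Ht; generalize (Rpower_1p_le_1 (p - 1) t ltac:(lra) ltac:(lra)); nra. }
  rewrite Rplus_0_r, Rpower_base_1 in I'; lra.
Qed.

Lemma Lfun_0 (alpha : R) : Lfun 0 alpha = 0.
Proof.
  unfold Lfun; destruct (Req_EM_T alpha 0) as [|N0]; [|destruct (Req_EM_T alpha (1 / 2)) as [|N1]].
  - rewrite Rplus_0_r, ln_1; field.
  - rewrite Rplus_0_r, ln_1; field.
  - rewrite Rplus_0_r, Rpower_base_1; field; split; lra.
Qed.

(** The three formulas are primitives of one integrand, 2 (1+x)^(2 alpha - 2) - (1+x)^(2 alpha - 1);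
    at alpha = 1/2 and alpha = 0 one of the two powers is -1 and integrates to a logarithm. *)
Lemma Lfun_derive (alpha x : R) :
  0 <= x -> is_derive (fun r => Lfun r alpha) x ((1 - x) * Rpower (1 + x) (2 * alpha - 2)).
Proof.
  intros Hx; unfold Lfun, Rpower.
  assert (E : exp ((2 * alpha - 2) * ln (1 + x)) =
     exp (2 * alpha * ln (1 + x)) / ((1 + x) * (1 + x))).
  { replace ((2 * alpha - 2) * ln (1 + x)) with
      (2 * alpha * ln (1 + x) + (- ln (1 + x) + - ln (1 + x))) by ring.
    rewrite !exp_plus, exp_Ropp, exp_ln by lra; field; lra. }
  rewrite E.
  destruct (Req_EM_T alpha 0) as [->|N0]; [|destruct (Req_EM_T alpha (1 / 2)) as [->|N1]].
  - replace (2 * 0 * ln (1 + x)) with 0 by ring; rewrite exp_0.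
    auto_derive; [lra|field; lra].
  - replace (2 * (1 / 2) * ln (1 + x)) with (ln (1 + x)) by field; rewrite exp_ln by lra.
    auto_derive; [lra|field; lra].
  - auto_derive.
    + repeat split; try lra; repeat apply Rmult_integral_contrapositive_currified; lra.
    + field; repeat split; lra.
Qed.

Lemma Lfun_nonneg (alpha r : R) : 0 <= r < 1 -> 0 <= Lfun r alpha.
Proof.
  intros Hr; rewrite <- (Lfun_0 alpha).
  apply (increasing_of_derive (fun r => Lfun r alpha)
    (fun x => (1 - x) * Rpower (1 + x) (2 * alpha - 2)) 0 r); [lra| |].
  - intros; apply Lfun_derive; lra.
  - intros; apply Rmult_le_pos; [lra|apply Rlt_le, exp_pos].
Qed.

(** Divided by (1+x)^(alpha - 5/2), the comparison of derivatives becomes (1-x)(1+x)^(alpha + 1/2)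
    <= 1 + (alpha - 1/2) x. *)
Lemma Lfun_upper (alpha r : R) :
  0 <= alpha < 1 -> 0 <= r < 1 -> Lfun r alpha <= r * Rpower (1 + r) (alpha - 3 / 2).
Proof.
  intros Ha Hr.
  assert (I := increasing_of_derive
    (fun x => x * Rpower (1 + x) (alpha - 3 / 2) - Lfun x alpha)
    (fun x => Rpower (1 + x) (alpha - 3 / 2) +
       x * ((alpha - 3 / 2) * Rpower (1 + x) (alpha - 3 / 2 - 1)) -
       (1 - x) * Rpower (1 + x) (2 * alpha - 2)) 0 r (proj1 Hr)).
  assert (I' : 0 * Rpower (1 + 0) (alpha - 3 / 2) - Lfun 0 alpha <=
    r * Rpower (1 + r) (alpha - 3 / 2) - Lfun r alpha).
  { apply I.
    - intros x Hx; apply (is_derive_minus (V := R_NormedModule)).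
      + assert (D := is_derive_mult (fun x => x) _ x _ _ (is_derive_id x)
          (is_derive_Rpower_1p (alpha - 3 / 2) x ltac:(lra)) Rmult_comm).
        unfold plus, mult, one in D; simpl in D; rewrite Rmult_1_l in D; exact D.
      + apply Lfun_derive; lra.
    - intros x Hx.
      set (P := Rpower (1 + x) (alpha - 3 / 2 - 1)).
      assert (PP : 0 < P) by apply exp_pos.
      assert (E1 : Rpower (1 + x) (alpha - 3 / 2) = P * (1 + x)).
      { replace (alpha - 3 / 2) with ((alpha - 3 / 2 - 1) + 1) by ring.
        rewrite Rpower_plus, Rpower_1 by lra; reflexivity. }
      assert (E2 : Rpower (1 + x) (2 * alpha - 2) = P * Rpower (1 + x) (alpha + 1 / 2)).
      { unfold P; rewrite <- Rpower_plus; f_equal; field. }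
      rewrite E1, E2.
      set (W := Rpower (1 + x) (alpha + 1 / 2)).
      assert (HW : (1 - x) * W <= 1 + x * (alpha - 1 / 2)).
      (* Bernoulli needs an exponent in [0, 1]. For alpha > 1/2 the exponent alpha + 1/2 exceeds 1,
         so a factor 1 + x is split off and absorbed in (1-x)(1+x) <= 1. *)
      { destruct (Rle_lt_dec alpha (1 / 2)) as [L|L].
        - assert (B : W <= 1 + (alpha + 1 / 2) * x) by (apply Rpower_bernoulli; lra).
          apply Rle_trans with ((1 - x) * (1 + (alpha + 1 / 2) * x)); [nra|].
          assert (0 <= (alpha + 1 / 2) * (x * x)) by (apply Rmult_le_pos; nra).
          nra.
        - assert (B := Rpower_bernoulli (alpha - 1 / 2) x ltac:(lra) ltac:(lra)).
          assert (EW : W = (1 + x) * Rpower (1 + x) (alpha - 1 / 2)).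
          { unfold W; replace (alpha + 1 / 2) with (1 + (alpha - 1 / 2)) by field.
            rewrite Rpower_plus, Rpower_1 by lra; reflexivity. }
          rewrite EW.
          apply Rle_trans with ((1 - x) * ((1 + x) * (1 + (alpha - 1 / 2) * x))).
          + apply Rmult_le_compat_l; [lra|]; apply Rmult_le_compat_l; lra.
          + assert (0 <= (1 + (alpha - 1 / 2) * x) * (x * x))
              by (apply Rmult_le_pos; nra).
            nra. }
      nra. }
  rewrite Lfun_0 in I'; lra.
Qed.

Lemma Afun_upper (alpha r : R) :
  0 <= alpha < 1 -> 0 < r < 1 ->
  Afun r alpha <= (1 - r) * Rpower (1 + r) (- (2 * (1 - alpha))).
Proof.
  intros Ha Hr.
  assert (U := Lfun_upper alpha r Ha ltac:(lra)).
  assert (N := Lfun_nonneg alpha r ltac:(lra)).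
  unfold Afun.
  set (P := Rpower (1 + r) (alpha - 3 / 2)) in *.
  assert (E : P * P * (1 + r) = Rpower (1 + r) (- (2 * (1 - alpha)))).
  { unfold P; rewrite <- (Rpower_1 (1 + r)) at 3 by lra.
    rewrite <- !Rpower_plus; f_equal; field. }
  rewrite <- E.
  replace ((1 - r) * (P * P * (1 + r))) with ((1 - r ^ 2) / r ^ 2 * (r * P) ^ 2) by (field; lra).
  apply Rmult_le_compat_l; [apply Rdiv_le_0_compat; nra|].
  apply pow_incr; lra.
Qed.

Lemma cderiv_cder (f : C -> C) (z l : C) : cderiv f z l -> cder f z l.
Proof.
  intros H eps Heps; destruct (H eps Heps) as [d [Hd K]].
  exists d; split; auto; intros w Hw.
  destruct (Ceq_dec w z) as [->|N].
  { replace (f z - f z - l * (z - z))%C with (RtoC 0) by ring.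
    replace (z - z)%C with (RtoC 0) by ring; rewrite Cmod_0; lra. }
  specialize (K w N Hw).
  change (Cmod ((f w - f z) / (w - z) - l)%C < eps) in K.
  assert (N' := Cminus_neq_0 _ _ N); assert (P := proj1 (Cmod_gt_0 _) N').
  replace (f w - f z - l * (w - z))%C with (((f w - f z) / (w - z) - l) * (w - z))%C
    by (field; auto).
  rewrite Cmod_mult; nra.
Qed.

Lemma Rpower_opp_le (x y p : R) : 0 < x <= y -> 0 <= p -> Rpower y (- p) <= Rpower x (- p).
Proof.
  intros H Hp; unfold Rpower; apply exp_le.
  assert (ln x <= ln y) by (apply ln_le; lra); nra.
Qed.

Lemma chord_lower_bound (alpha r : R) (h g : C -> C) (a b : C) :
  0 <= alpha < 1 -> in_F alpha h g -> 0 < r < 1 -> Cmod a <= r -> Cmod b <= r ->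
  Rpower (1 + r) (- (2 * (1 - alpha))) * Cmod (a - b)%C <= Cmod (h a - h b)%C /\
  Cmod (g a - g b)%C <= r * Cmod (h a - h b)%C.
Proof.
  intros Ha (h1 & h2 & g1 & theta & Hh & Hh1 & Hg & _ & _ & H0 & Hre & Hg1) Hr Hma Hmb.
  assert (HD : convex_data h h1 h2).
  { split; [|split; [|split]].
    - intros z Hz; apply cderiv_cder, Hh, Hz.
    - intros z Hz; split; [apply cderiv_cder, Hh1, Hz|apply (Hre z Hz)].
    - exact H0.
    - intros z Hz; apply Rle_lt_trans with alpha; [lra|apply (Hre z Hz)]. }
  assert (Dist : forall z, Cmod z <= r ->
    Rpower (1 + r) (- (2 * (1 - alpha))) <= Cmod (h1 z)).
  { intros z Hz; assert (P := Cmod_ge_0 z).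
    apply Rle_trans with (Rpower (1 + Cmod z) (- (2 * (1 - alpha)))).
    - apply Rpower_opp_le; lra.
    - apply (distortion_lower (1 - alpha) h1 h2); [lra|lra|apply HD|exact H0|].
      intros w Hw; destruct (Hre w Hw) as [_ Q].
      change (alpha < Re (1 + w * h2 w / h1 w)%C) in Q.
      rewrite re_plus, re_RtoC in Q; lra. }
  set (m := Rpower (1 + r) (- (2 * (1 - alpha)))) in *.
  assert (Pm : 0 < m) by apply exp_pos.
  split.
  (* With G the identity, the hypothesis on G1/h1 is the lower bound [m] on |h1|, and the conclusion
     bounds chords of the disc by chords of the image. *)
  - assert (K := increment_ratio_bound h h1 h2 (fun z => z) (fun _ => 1) r (/ m) a b HD Hr
      (fun z _ => cder_id z)).
    apply (Rmult_le_reg_l (/ m)); [apply Rinv_0_lt_compat; lra|].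
    rewrite <- Rmult_assoc, Rinv_l, Rmult_1_l by lra.
    apply K; auto.
    intros z Hz; rewrite Cmod_1; specialize (Dist z Hz).
    apply (Rmult_le_reg_l m); auto.
    rewrite <- Rmult_assoc, Rinv_r by lra; lra.
  - apply (increment_ratio_bound h h1 h2 g g1 r); auto.
    + intros z Hz; apply cderiv_cder, Hg; unfold inD; change (Cmod z < 1); lra.
    + intros z Hz; rewrite Hg1 by (unfold inD; change (Cmod z < 1); lra).
      change (Cmod (cis theta * (z * h1 z))%C <= r * Cmod (h1 z)).
      rewrite !Cmod_mult, Cmod_cis, Rmult_1_l.
      apply Rmult_le_compat_r; [apply Cmod_ge_0|auto].
Qed.

Import Defs.

Theorem theorem1 :
  forall (alpha : R) (h g : Cpx -> Cpx),
    0 <= alpha < 1 ->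
    in_F alpha h g ->
    forall (r : R) (lam : Cpx) (t psi : R),
      0 < r < 1 ->
      Cmod lam = 1 ->
      polar r t <> polar r psi ->
      let Flam := fun z => Cadd (h z) (Cmul lam (g z)) in
      let f := fun z => Cadd (h z) (Cconj (g z)) in
      Afun r alpha <=
        Cmod (Cdiv (Csub (Flam (polar r t)) (Flam (polar r psi)))
                   (Csub (polar r t) (polar r psi))) /\
      Afun r alpha <=
        Cmod (Cdiv (Csub (f (polar r t)) (f (polar r psi)))
                   (Csub (polar r t) (polar r psi))).
Proof.
  intros alpha h g Ha HF r lam t psi Hr Hlam N Flam f.
  assert (HA := Afun_upper alpha r Ha Hr).
  set (m := Rpower (1 + r) (- (2 * (1 - alpha)))) in *.
  assert (Pm : 0 < m) by apply exp_pos.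
  assert (Hp : forall s, Complex.Cmod (polar r s) = r).
  { intros s; change (Complex.Cmod (Complex.RtoC r * cis s)%C = r).
    rewrite Cmod_mult, Cmod_cis, Cmod_R, Rabs_pos_eq; lra. }
  set (a := polar r t) in *; set (b := polar r psi) in *.
  assert (Ma : Complex.Cmod a <= r) by (unfold a; rewrite Hp; lra).
  assert (Mb : Complex.Cmod b <= r) by (unfold b; rewrite Hp; lra).
  destruct (chord_lower_bound alpha r h g a b Ha HF Hr Ma Mb) as [K1 K2]; fold m in K1.
  assert (N' := Cminus_neq_0 a b N); assert (P := proj1 (Cmod_gt_0 _) N').
  (* Here [v] is the increment of lam g or of conj g. In both cases |v| <= r |h a - h b|, so |w| >=
     (1 - r) |h a - h b| >= (1 - r) m |a - b|. *)
  assert (Fin : forall w v : Complex.C, Complex.Cmod v = Complex.Cmod (g a - g b)%C ->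
    w = (h a - h b + v)%C -> Afun r alpha <= Complex.Cmod (w / (a - b))%C).
  { intros w v Hv ->; rewrite Cmod_div by auto.
    apply Rle_trans with ((1 - r) * m); auto.
    apply (Rmult_le_reg_r (Complex.Cmod (a - b)%C)); auto.
    unfold Rdiv; rewrite (Rmult_assoc (Complex.Cmod _)), Rinv_l by lra.
    assert (T := Cmod_triangle_sub (h a - h b)%C (- v)%C).
    rewrite Cmod_opp, Hv in T.
    replace (h a - h b - - v)%C with (h a - h b + v)%C in T by ring.
    nra. }
  split.
  - apply (Fin _ (lam * (g a - g b))%C).
    + rewrite Cmod_mult; change (Complex.Cmod lam) with (Cmod lam); rewrite Hlam; ring.
    + change ((h a + lam * g a) - (h b + lam * g b) = h a - h b + lam * (g a - g b))%C; ring.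
  - apply (Fin _ (Complex.Cconj (g a - g b)%C)).
    + apply Cmod_conj.
    + unfold f, Csub, Cadd, Copp, Cconj, Complex.Cconj, Cminus, Cplus, Complex.Copp; simpl.
      f_equal; ring.
Qed.
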